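(* There is a $(=2)$-string graph which is not an odd-string graph.
   Context: Graphs are finite, simple and undirected. A string representation of a graph $G=(V,E)$ is a collection $R=\{R(v): v\in V\}$ of curves in the plane such that for any two distinct vertices $u,v\in V$, $R(u)\cap R(v)\neq\emptyset$ if and only if $\{u,v\}\in E$. A string representation $R$ is proper if every curve in $R$ is a simple piecewise linear curve with finitely many bends, any two curves in $R$ intersect in at most finitely many points, no three curves in $R$ intersect in one point, and no intersection point of two curves coincides with a bend or an endpoint of a curve (so every intersection of two curves is a crossing). A $(=2)$-string graph is a graph having a proper string representation in which any two curves are either disjoint or intersect in precisely $2$ points. An odd-string graph is a graph having a proper string representation in which any two curves are either disjoint or cross in an odd number of points (the odd number may depend on the pair of curves). *)

(* Defs.v *)
From HB Require Import structures.
From mathcomp Require Import all_boot all_order all_algebra.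
From mathcomp Require Import boolp classical_sets functions cardinality reals.
Set Implicit Arguments.
Unset Strict Implicit.
Unset Printing Implicit Defensive.
Import Order.TTheory GRing.Theory Num.Theory.
Local Open Scope classical_set_scope.
Local Open Scope card_scope.
Local Open Scope ring_scope.

Notation plane R := (R^o * R^o)%type.

(** A piecewise linear curve is given by its vertex sequence
    [:: first endpoint; bends in order; last endpoint].  With n + 1 vertices
    it is parametrized by [0, n]: [pl_point s i t] is the point of parameter
    i + t, for i < n and 0 <= t <= 1. *)
Definition pl_point (R : realType) (s : seq (plane R)) (i : nat) (t : R)
  : plane R :=
  (1 - t) *: nth 0 s i + t *: nth 0 s i.+1.

Definition pl_curve (R : realType) (s : seq (plane R)) : set (plane R) :=
  [set p | exists i t, [/\ (i.+1 < size s)%N, 0 <= t <= 1 & p = pl_point s i t]].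

Definition collinear (R : realType) (p q r : plane R) : Prop :=
  (q.1 - p.1) * (r.2 - p.2) = (q.2 - p.2) * (r.1 - p.1).

(** [pl_simple] is injectivity of the parametrization on [0, n]; the vertex
    shared by two consecutive segments is the one point with two pairs (i, t),
    and both have the same i + t. *)
Definition pl_simple (R : realType) (s : seq (plane R)) : Prop :=
  forall (i j : nat) (t u : R),
    (i.+1 < size s)%N -> (j.+1 < size s)%N -> 0 <= t <= 1 -> 0 <= u <= 1 ->
    pl_point s i t = pl_point s j u -> i%:R + t = j%:R + u.

(** The last clause says that the interior vertices are genuine bends, so that
    the elements of [s] are exactly the endpoints and bends of the curve. *)
Definition simple_pl_curve (R : realType) (s : seq (plane R)) : Prop :=
  [/\ (1 < size s)%N,
      pl_simple s
    & forall i, (i.+2 < size s)%N ->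
        ~ collinear (nth 0 s i) (nth 0 s i.+1) (nth 0 s i.+2)].

Definition string_representation (R : realType) (V : finType) (E : rel V)
    (C : V -> set (plane R)) : Prop :=
  forall u v, u != v -> (C u `&` C v !=set0 <-> E u v).

(** Under these conditions two curves meeting at a point meet there in the
    relative interiors of two non-parallel segments, i.e. they cross. *)
Definition proper_string_representation (R : realType) (V : finType)
    (E : rel V) (r : V -> seq (plane R)) : Prop :=
  [/\ string_representation E (fun v => pl_curve (r v)),
      forall v, simple_pl_curve (r v),
      forall u v, u != v -> finite_set (pl_curve (r u) `&` pl_curve (r v)),
      forall u v w, u != v -> u != w -> v != w ->
        pl_curve (r u) `&` pl_curve (r v) `&` pl_curve (r w) = set0
    & forall u v w p, u != v -> (pl_curve (r u) `&` pl_curve (r v)) p ->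
        p \notin r w].

Definition eq2_string_graph (R : realType) (V : finType) (E : rel V) : Prop :=
  exists r : V -> seq (plane R),
    proper_string_representation E r /\
    forall u v, u != v ->
      pl_curve (r u) `&` pl_curve (r v) = set0 \/
      pl_curve (r u) `&` pl_curve (r v) #= `I_2.

Definition odd_string_graph (R : realType) (V : finType) (E : rel V) : Prop :=
  exists r : V -> seq (plane R),
    proper_string_representation E r /\
    forall u v, u != v ->
      pl_curve (r u) `&` pl_curve (r v) = set0 \/
      exists2 n, odd n & pl_curve (r u) `&` pl_curve (r v) #= `I_n.

(* Main.v *)
(** Each vertex [u] of the pentagonal bipyramid, a planar graph with 7 vertices
    and 15 = 2 * 7 + 1 edges, is turned into a string (a hub) enclosed in a ring
    of strings (its gates), one gate for each neighbour; hubs of adjacent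
    vertices cross.  A centre in each face, joined by spokes to the rings of the
    three corners of the face, makes a plane frame in which every edge of the
    bipyramid has a face of its own.

    In an odd representation, cut each hub at its first and last crossing with
    its ring.  The middle part closes up along the ring, the rings of [u] and [v]
    are disjoint, and closed curves cross an even number of times; so if the hubs
    [u] and [v] cross an odd number of times, an end piece of one of them meets
    the other.  There are 14 end pieces for 15 edges, hence an end piece of some
    [u] meets two hubs [v] and [w].  This piece and the two arcs of the frame
    that lead around [u] from [v] to [w] are then the three vertices on one side
    of a K_{3,3} drawn with disjoint independent edges; the rings of [u], [v] and
    [w] are the other side.

    Both parity facts follow from one formula.  For paths e from x to y and f from
    a to b, the number of crossings of e and f has the parity of the number of
    crossings of f with the horizontal rays to the right of x and y, plus that of e
    with the rays of a and b, plus 1 if the heights of x, y and of a, b interlace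
    (e and f extended by their rays are closed curves through infinity).  When
    summed over the independent pairs of edges of K_{3,3} the ray terms cancel and
    the number of interlacing pairs is odd. *)

From Stdlib Require Import ZArith.
Require Import Defs.
From mathcomp Require Import all_boot all_order all_algebra reals.
From mathcomp Require Import boolp classical_sets functions cardinality.
From mathcomp Require Import ring lra zify ssrZ.
Set Implicit Arguments.
Unset Strict Implicit.
Unset Printing Implicit Defensive.
Import Order.TTheory GRing.Theory Num.Theory.
Local Open Scope classical_set_scope.
Local Open Scope card_scope.
Local Open Scope ring_scope.
Delimit Scope Z_scope with binZ.

(** * Crossing parity of polylines *)

Section Segments.
Variable R : realType.
Implicit Types a b c d p q x y : plane R.

(** Twice the signed area of the triangle [a b c], positive when [c] is to the left of the line from
    [a] to [b]. *)
Definition orient a b c : R :=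
  (b.1 - a.1) * (c.2 - a.2) - (b.2 - a.2) * (c.1 - a.1).

Definition seg a b : set (plane R) :=
  [set p | exists2 t : R, 0 <= t <= 1 & p = (1 - t) *: a + t *: b].

Lemma combE (t : R) a b : (1 - t) *: a + t *: b =
  ((1 - t) * a.1 + t * b.1, (1 - t) * a.2 + t * b.2).
Proof. by []. Qed.

Lemma segP a b p : seg a b p <-> exists t : R, [/\ 0 <= t <= 1,
  p.1 = (1 - t) * a.1 + t * b.1 & p.2 = (1 - t) * a.2 + t * b.2].
Proof.
split=> [[t ht ->]|[t [ht h1 h2]]]; first by exists t.
by exists t => //; rewrite combE -h1 -h2 -surjective_pairing.
Qed.

Lemma seg_left a b : seg a b a.
Proof. by apply/segP; exists 0; split; lra. Qed.

Lemma seg_sym a b : seg a b = seg b a.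
Proof.
by apply/seteqP; split=> p /segP[t [? ? ?]]; apply/segP; exists (1 - t); split; lra.
Qed.

Lemma seg_right a b : seg a b b.
Proof. by rewrite seg_sym; exact: seg_left. Qed.

Lemma seg_refl a : seg a a = [set a].
Proof.
apply/seteqP; split=> [p /segP[t [_ h1 h2]]|p ->]; last exact: seg_left.
by rewrite /= [p]surjective_pairing [a]surjective_pairing h1 h2; congr (_, _); ring.
Qed.

Lemma orient_comb a b c d (t : R) :
  orient c d ((1 - t) *: a + t *: b) = (1 - t) * orient c d a + t * orient c d b.
Proof. by rewrite combE /orient /=; ring. Qed.

Definition crossing a b c d :=
  (orient a b c * orient a b d < 0) && (orient c d a * orient c d b < 0).

(** One segment lies strictly on one side of the line through the other. This is not the negation of
    [crossing]: touching segments satisfy neither. *)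
Definition separated a b c d :=
  (0 < orient a b c * orient a b d) || (0 < orient c d a * orient c d b).

Lemma orient_seg0 a b p : seg a b p -> orient a b p = 0.
Proof. by case=> t _ ->; rewrite combE /orient /=; ring. Qed.

Lemma seg_same_side a b c d p :
  0 < orient a b c * orient a b d -> seg c d p -> orient a b p != 0.
Proof.
move=> h [t ht ->]; rewrite orient_comb; apply/eqP => e.
move: h e ht; set u := orient a b c; set v := orient a b d => h e /andP[h0 h1].
have : (1 - t) * (u * u) + t * (u * v) = 0 by rewrite -[RHS](mulr0 u) -e; ring.
have uu : 0 < u * u by nra.
have [t0|t0] : t <= 1 / 2%:R \/ 1 / 2%:R <= t by lra.
  have : 0 < (1 - t) * (u * u) by nra.
  have : 0 <= t * (u * v) by nra.
  lra.
have : 0 < t * (u * v) by nra.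
have : 0 <= (1 - t) * (u * u) by nra.
lra.
Qed.

Lemma separatedP a b c d p : separated a b c d -> seg a b p -> seg c d p -> False.
Proof.
move=> /orP[] h ab cd.
  by have := seg_same_side h cd; rewrite (orient_seg0 ab) eqxx.
by have := seg_same_side h ab; rewrite (orient_seg0 cd) eqxx.
Qed.

Lemma crossing_uniq a b c d p q : crossing a b c d ->
  seg a b p -> seg c d p -> seg a b q -> seg c d q -> p = q.
Proof.
move=> /andP[_ h] [t ht ->] /orient_seg0; rewrite orient_comb => et.
move=> [s hs ->] /orient_seg0; rewrite orient_comb => es.
suff -> : t = s by [].
move: h et es; set u := orient c d a; set v := orient c d b => h et es.
have huv : u - v != 0 by apply/eqP; nra.
by apply: (mulIf huv); lra.
Qed.

(** [x / (x - y)] is the zero of the affine function with value [x] at 0 and [y] at 1. *)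
Lemma ratio01 (x y : R) : x * y < 0 -> 0 <= x / (x - y) <= 1.
Proof.
move=> xy; have [x0|x0] := ltP 0 x.
  have y0 : y < 0 by nra.
  by rewrite divr_ge0 /= ?ler_pdivrMr; lra.
have {}x0 : x < 0.
  by rewrite lt_neqAle x0 andbT; apply/eqP => e; move: xy; rewrite e mul0r ltxx.
have y0 : 0 < y by nra.
have -> : x / (x - y) = (- x) / (y - x) by rewrite -mulrNN -invrN opprB.
by rewrite divr_ge0 /= ?ler_pdivrMr; lra.
Qed.

(** Orientation is affine along a segment, so its zeros give the parameters [w / (w - z)] on [a b]
    and [u / (u - v)] on [c d]. As [w - z = v - u], the two points can be compared after clearing
    one denominator. *)
Lemma crossing_meet a b c d : crossing a b c d ->
  exists2 p, seg a b p & seg c d p.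
Proof.
move=> /andP[].
set u := orient a b c; set v := orient a b d; set w := orient c d a; set z := orient c d b.
move=> h1 h2.
have hs : w - z = v - u by rewrite /u /v /w /z /orient; ring.
have hd : w - z != 0 by apply/eqP; nra.
have hd' : u - v != 0 by apply/eqP; nra.
exists ((1 - w / (w - z)) *: a + (w / (w - z)) *: b).
  by exists (w / (w - z)) => //; exact: ratio01.
exists (u / (u - v)); first exact: ratio01.
have e1 : u / (u - v) = - (u / (w - z)) by rewrite -mulrN -invrN; congr (_ / _); lra.
rewrite e1 !combE.
have dd : (b.1 - a.1) * (d.2 - c.2) - (b.2 - a.2) * (d.1 - c.1) = v - u.
  by rewrite /u /v /orient; ring.
congr (_, _); apply: (mulIf hd).
  have -> : ((1 - w / (w - z)) * a.1 + w / (w - z) * b.1) * (w - z) =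
    (w - z) * a.1 - w * a.1 + w * b.1 by field.
  have -> : ((1 - - (u / (w - z))) * c.1 + - (u / (w - z)) * d.1) * (w - z) =
    (w - z) * c.1 + u * c.1 - u * d.1 by field.
  by rewrite /u /w /z /orient; ring.
have -> : ((1 - w / (w - z)) * a.2 + w / (w - z) * b.2) * (w - z) =
    (w - z) * a.2 - w * a.2 + w * b.2 by field.
have -> : ((1 - - (u / (w - z))) * c.2 + - (u / (w - z)) * d.2) * (w - z) =
    (w - z) * c.2 + u * c.2 - u * d.2 by field.
by rewrite /u /w /z /orient; ring.
Qed.

Lemma crossing_endpoint a b c d : crossing a b c d ->
  [/\ ~ seg c d a, ~ seg c d b, ~ seg a b c & ~ seg a b d].
Proof.
by move=> /andP[h1 h2]; split=> /orient_seg0 e; move: h1 h2; rewrite e ?mul0r ?mulr0 ltxx.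
Qed.

End Segments.

(** * Segments whose endpoints avoid each other *)

Section Generic.
Variable R : realType.
Implicit Types a b c d p q x y : plane R.

(** Properness of a representation gives this for segments of different curves. *)
Definition generic a b c d :=
  [/\ ~ seg c d a, ~ seg c d b, ~ seg a b c & ~ seg a b d].

Lemma generic_swap a b c d : generic a b c d -> generic c d a b.
Proof. by case. Qed.

Lemma orient0_comb c d a : c != d -> orient c d a = 0 ->
  exists t : R, a = (1 - t) *: c + t *: d.
Proof.
case: a c d => [a1 a2] [c1 c2] [d1 d2]; rewrite /orient /= => cd e.
have [e1|n1] := eqVneq (d1 - c1) 0.
  have n2 : d2 - c2 != 0.
    apply/eqP => e2; move/eqP: cd; apply.
    have -> : c1 = d1 by lra.
    by have -> : c2 = d2 by lra.
  exists ((a2 - c2) / (d2 - c2)); rewrite combE /=; congr (_, _).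
    have : (d2 - c2) * (a1 - c1) = 0 by move: e; rewrite e1; lra.
    move/eqP; rewrite mulf_eq0 (negbTE n2) /= => /eqP h.
    have -> : d1 = c1 by lra.
    have -> : a1 = c1 by lra.
    ring.
  by field.
exists ((a1 - c1) / (d1 - c1)); rewrite combE /=; congr (_, _); first by field.
apply: (mulIf n1).
have -> : ((1 - (a1 - c1) / (d1 - c1)) * c2 + (a1 - c1) / (d1 - c1) * d2) * (d1 - c1)
   = c2 * (d1 - c1) + (d2 - c2) * (a1 - c1) by field.
lra.
Qed.

Lemma comb_comb (t x y : R) c d :
  (1 - t) *: ((1 - x) *: c + x *: d) + t *: ((1 - y) *: c + y *: d) =
  (1 - ((1 - t) * x + t * y)) *: c + ((1 - t) * x + t * y) *: d.
Proof. by rewrite !combE /=; congr (_, _); ring. Qed.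

Lemma comb_inj (t s : R) c d : c != d ->
  (1 - t) *: c + t *: d = (1 - s) *: c + s *: d -> t = s.
Proof.
case: c d => [c1 c2] [d1 d2]; rewrite !combE /= => cd [e1 e2].
apply/eqP; rewrite -subr_eq0; apply/negPn/negP => n.
have h1 : (t - s) * (d1 - c1) = 0 by lra.
have h2 : (t - s) * (d2 - c2) = 0 by lra.
move/eqP: cd; apply; congr (_, _).
  by move/eqP: h1; rewrite mulf_eq0 (negbTE n) /= => /eqP; lra.
by move/eqP: h2; rewrite mulf_eq0 (negbTE n) /= => /eqP; lra.
Qed.

Lemma conv_lt0 (t x y : R) : 0 <= t <= 1 -> x < 0 -> y < 0 ->
  (1 - t) * x + t * y < 0.
Proof.
move=> ht x0 y0; have [h|h] := leP x y.
  have : (1 - t) * (y - x) >= 0 by nra.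
  lra.
have : t * (x - y) >= 0 by nra.
lra.
Qed.

(** The parameters [x], [y] of [a], [b] on the line [c d] are outside [0, 1], but a convex
    combination of them is inside. Hence they lie on different sides of [0, 1], and [c], whose
    parameter is 0, is on [a b]. *)
Lemma collinear_meet a b c d p : orient c d a = 0 -> orient c d b = 0 ->
  seg a b p -> seg c d p -> ~ generic a b c d.
Proof.
move=> ea eb ab cd [ga gb gc gd].
have [e|ncd] := eqVneq c d.
  by move: cd; rewrite -e seg_refl /= => ep; apply: gc; rewrite -ep.
have [x ex] := orient0_comb ncd ea; have [y ey] := orient0_comb ncd eb.
have [s hs es] := cd; have [t ht] := ab.
rewrite ex ey comb_comb es => /(comb_inj ncd) e.
have nx : ~ (0 <= x <= 1) by move=> h; apply: ga; exists x.
have ny : ~ (0 <= y <= 1) by move=> h; apply: gb; exists y.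
have xy : x * y < 0.
  have [x0|x0] := ltP x 0.
    have [y0|y0] := ltP y 0; first by have := conv_lt0 ht x0 y0; lra.
    have y1 : 1 < y by rewrite ltNge; apply/negP => y1; apply: ny; rewrite y0.
    nra.
  have x1 : 1 < x by rewrite ltNge; apply/negP => x1; apply: nx; rewrite x0.
  have [y0|y0] := ltP y 0; first by nra.
  have y1 : 1 < y by rewrite ltNge; apply/negP => y1; apply: ny; rewrite y0.
  have x1' : 1 - x < 0 by lra.
  have y1' : 1 - y < 0 by lra.
  by have := conv_lt0 ht x1' y1'; lra.
apply: gc; exists (x / (x - y)); first exact: ratio01.
rewrite ex ey comb_comb.
have n : x - y != 0 by apply/eqP; nra.
have -> : (1 - x / (x - y)) * x + x / (x - y) * y = 0 by field.
by rewrite subr0 scale1r scale0r addr0.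
Qed.

(** The common point is interior to [a b], so a mean of [w] and [z] with positive weights is 0. If
    they do not have opposite signs, both vanish and the segments are collinear. *)
Lemma meet_opposite a b c d p : generic a b c d -> seg a b p -> seg c d p ->
  orient c d a * orient c d b < 0.
Proof.
move=> g ab cd; rewrite ltNge; apply/negP => h.
suff [ea eb] : orient c d a = 0 /\ orient c d b = 0.
  exact: (collinear_meet ea eb ab cd).
have := orient_seg0 cd; case: (ab) => t ht ep; rewrite {1}ep orient_comb.
move: h; set w := orient c d a; set z := orient c d b => h e.
have tn1 : t != 1.
  apply/eqP => t1; case: g => _ gb _ _; apply: gb; move: cd.
  by rewrite ep t1 subrr scale0r scale1r add0r.
have tn0 : t != 0.
  apply/eqP => t0; case: g => ga _ _ _; apply: ga; move: cd.
  by rewrite ep t0 subr0 scale0r scale1r addr0.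
have t0 : 0 < t by rewrite lt_neqAle eq_sym tn0; lra.
have t1 : t < 1 by rewrite lt_neqAle tn1; lra.
have e1 : (1 - t) * (w * w) + t * (w * z) = 0 by rewrite -[RHS](mulr0 w) -e; ring.
have e2 : (1 - t) * (w * z) + t * (z * z) = 0 by rewrite -[RHS](mulr0 z) -e; ring.
have ww : 0 <= w * w by exact: sqr_ge0.
have zz : 0 <= z * z by exact: sqr_ge0.
have twz : 0 <= t * (w * z) by nra.
have twz' : 0 <= (1 - t) * (w * z) by nra.
split; apply/eqP; rewrite -sqrf_eq0 expr2; apply/eqP; nra.
Qed.

Lemma generic_crossing a b c d p :
  generic a b c d -> seg a b p -> seg c d p -> crossing a b c d.
Proof.
move=> g ab cd; rewrite /crossing (meet_opposite g ab cd).
by rewrite (meet_opposite (generic_swap g) cd ab).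
Qed.

End Generic.

(** * The crossing formula for two segments *)

Section CrossingParity.
Variable R : realType.
Implicit Types a b c d p q x y : plane R.

(** Applied to [l1 = (a <= c)], [l2 = (b <= c)] (heights) and [o = orient a b c]:
    the ray to the right of [c] crosses the segment from [a] to [b]. *)
Definition upward_left (l1 l2 : bool) (o : R) :=
  (l1 (+) l2) && (if l1 then 0 < o else o < 0).

Lemma upward_leftC l1 l2 o : upward_left l2 l1 (- o) = upward_left l1 l2 o.
Proof. by rewrite /upward_left addbC oppr_gt0 oppr_lt0; case: l1 l2 => [] []. Qed.

(** The crossing formula for a pair of segments. The order is a parameter because plain heights are
    treated first and lexicographic heights afterwards. *)
Definition parity4 (le : rel (plane R)) a b c d :=
  upward_left (le c a) (le d a) (orient c d a) (+)
  upward_left (le c b) (le d b) (orient c d b) (+)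
  upward_left (le a c) (le b c) (orient a b c) (+)
  upward_left (le a d) (le b d) (orient a b d) (+)
  (le a c (+) le a d (+) le b c (+) le b d).

Lemma orientC a b c : orient b a c = - orient a b c.
Proof. by rewrite /orient; ring. Qed.

Lemma crossingC a b c d : crossing a b c d = crossing c d a b.
Proof. by rewrite /crossing andbC. Qed.

Lemma crossing_revl a b c d : crossing b a c d = crossing a b c d.
Proof. by rewrite /crossing !(orientC a b) mulrNN (mulrC (orient c d b)). Qed.

Lemma parity4_revl le a b c d : parity4 le b a c d = parity4 le a b c d.
Proof.
rewrite /parity4 !(orientC a b) !upward_leftC; congr (_ (+) _).
  by do 4!case: (upward_left _ _ _).
by do 4!case: (le _ _).
Qed.

Lemma parity4C le a b c d :
  (forall x y, x \in [:: a; b] -> y \in [:: c; d] -> le y x = ~~ le x y) ->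
  parity4 le c d a b = parity4 le a b c d.
Proof.
move=> h; rewrite /parity4 ?(h a c, h a d, h b c, h b d) ?inE ?eqxx ?orbT //.
congr (_ (+) _); first by do 4!case: (upward_left _ _ _).
by do 4!case: (le _ _).
Qed.

Definition le2 : rel (plane R) := fun p q => p.2 <= q.2.

(** Here [a] is lowest. If [b] is below [c], the height ranges are disjoint. If [d] is below [b],
    the segments cross when [c] and [d] are on different sides of [a b]. Otherwise the heights
    interlace, and the segments cross when [orient a b c] and [orient c d b] have the same sign. The
    dependency [dep] yields the other signs. *)
Lemma parity4_sorted a b c d : a.2 <= b.2 -> c.2 <= d.2 -> a.2 < c.2 ->
  (forall x y, x \in [:: a; b] -> y \in [:: c; d] -> x.2 != y.2) ->
  (forall x, x \in [:: a; b] -> le2 c x (+) le2 d x -> orient c d x != 0) ->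
  (forall x, x \in [:: c; d] -> le2 a x (+) le2 b x -> orient a b x != 0) ->
  parity4 le2 a b c d = crossing a b c d.
Proof.
move=> ab cd ac ne hcd hab.
have {ne} [nbc nbd] : b.2 != c.2 /\ b.2 != d.2 by split; apply: ne; rewrite !inE eqxx ?orbT.
have {hcd} zb : le2 c b (+) le2 d b -> orient c d b != 0.
  by apply: hcd; rewrite !inE eqxx ?orbT.
have [uc vd] : (le2 a c (+) le2 b c -> orient a b c != 0) /\
    (le2 a d (+) le2 b d -> orient a b d != 0).
  by split; apply: hab; rewrite !inE eqxx ?orbT.
have ad : a.2 < d.2 by lra.
rewrite /parity4; move: zb uc vd; rewrite /le2 (ltW ac) (ltW ad).
have -> : (c.2 <= a.2) = false by apply/negbTE; rewrite -ltNge.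
have -> : (d.2 <= a.2) = false by apply/negbTE; rewrite -ltNge.
(* The affine dependency of the four points, evaluated at the height minus [k]. *)
have dep k : orient c d b * (a.2 - k) - orient c d a * (b.2 - k) +
    orient a b d * (c.2 - k) - orient a b c * (d.2 - k) = 0.
  by rewrite /orient; ring.
have [bc|cb] : b.2 < c.2 \/ c.2 <= b.2 by lra.
  have bd : b.2 < d.2 by lra.
  rewrite (ltW bc) (ltW bd).
  have -> : (c.2 <= b.2) = false by apply/negbTE; rewrite -ltNge.
  have -> : (d.2 <= b.2) = false by apply/negbTE; rewrite -ltNge.
  move=> _ _ _; rewrite /upward_left /=; apply/esym/negbTE/negP => /crossing_meet[p].
  move=> /segP[t [ht _ e1]] /segP[s [hs _ e2]].
  have : p.2 <= b.2 by rewrite e1; nra.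
  have : c.2 <= p.2 by rewrite e2; nra.
  lra.
have {nbc} {}cb : c.2 < b.2 by rewrite lt_neqAle eq_sym nbc.
have -> : (b.2 <= c.2) = false by apply/negbTE; rewrite -ltNge.
rewrite (ltW cb) /upward_left /crossing.
have da := dep a.2; have db := dep b.2; have dc := dep c.2; have dd := dep d.2.
move: da db dc dd.
set u := orient a b c; set v := orient a b d; set w := orient c d a; set z := orient c d b.
move=> da db dc dd.
have [db'|bd] : d.2 < b.2 \/ b.2 <= d.2 by lra.
  have -> : (b.2 <= d.2) = false by apply/negbTE; rewrite -ltNge.
  rewrite (ltW db') /= => _ /(_ isT) u0 /(_ isT) v0.
  have [u1|u1] : u < 0 \/ 0 < u by case: (ltgtP u 0) u0; [left|right|].
    have [v1|v1] : v < 0 \/ 0 < v by case: (ltgtP v 0) v0; [left|right|].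
      have -> : (u * v < 0) = false by apply/negbTE; rewrite -leNgt; nra.
      by rewrite !ltNge (ltW u1) (ltW v1).
    have -> : u * v < 0 by nra.
    have -> : w * z < 0.
      have : z < 0 by nra.
      have : 0 < w by nra.
      nra.
    by rewrite v1 ltNge (ltW u1).
  have [v1|v1] : v < 0 \/ 0 < v by case: (ltgtP v 0) v0; [left|right|].
    have -> : u * v < 0 by nra.
    have -> : w * z < 0.
      have : 0 < z by nra.
      have : w < 0 by nra.
      nra.
    by rewrite u1 ltNge (ltW v1).
  have -> : (u * v < 0) = false by apply/negbTE; rewrite -leNgt; nra.
  by rewrite u1 v1.
have {nbd} {}bd : b.2 < d.2 by rewrite lt_neqAle nbd.
have -> : (d.2 <= b.2) = false by apply/negbTE; rewrite -ltNge.
rewrite (ltW bd) /= => /(_ isT) z0 /(_ isT) u0 _.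
have [u1|u1] : u < 0 \/ 0 < u by case: (ltgtP u 0) u0; [left|right|].
  have [z1|z1] : z < 0 \/ 0 < z by case: (ltgtP z 0) z0; [left|right|].
    have -> : u * v < 0.
      have : 0 < v by nra.
      nra.
    have -> : w * z < 0.
      have : 0 < w by nra.
      nra.
    by rewrite !ltNge (ltW u1) (ltW z1).
  have -> : (u * v < 0) && (w * z < 0) = false.
    apply/negbTE/negP => /andP[uv wz].
    have : 0 < v by nra.
    have : w < 0 by nra.
    nra.
  by rewrite z1 ltNge (ltW u1).
have [z1|z1] : z < 0 \/ 0 < z by case: (ltgtP z 0) z0; [left|right|].
  have -> : (u * v < 0) && (w * z < 0) = false.
    apply/negbTE/negP => /andP[uv wz].
    have : v < 0 by nra.
    have : 0 < w by nra.
    nra.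
  by rewrite u1 ltNge (ltW z1).
have -> : u * v < 0.
  have : v < 0 by nra.
  nra.
have -> : w * z < 0.
  have : w < 0 by nra.
  nra.
by rewrite u1 z1.
Qed.
End CrossingParity.

(** * Breaking ties in height *)

Section LexicographicHeight.
Variable R : realType.
Implicit Types a b c d p q x y : plane R.

(** Reversing a segment or exchanging the two preserves both sides, so the lowest endpoint may be
    called [a]. *)
Lemma parity4_le2 a b c d :
  (forall x y, x \in [:: a; b] -> y \in [:: c; d] -> x.2 != y.2) ->
  (forall x, x \in [:: a; b] -> le2 c x (+) le2 d x -> orient c d x != 0) ->
  (forall x, x \in [:: c; d] -> le2 a x (+) le2 b x -> orient a b x != 0) ->
  parity4 (@le2 R) a b c d = crossing a b c d.
Proof.
have leN x y : x.2 != y.2 -> le2 y x = ~~ le2 x y.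
  by rewrite /le2 -ltNge lt_neqAle eq_sym => ->.
have C2 (x y : plane R) : [:: x; y] =i [:: y; x] by move=> z; rewrite !inE orbC.
wlog ab : a b / a.2 <= b.2.
  move=> H hne hcd hab; have [|/ltW ba] := leP a.2 b.2; first by move/H; apply.
  rewrite -parity4_revl -crossing_revl; apply: H => // [x y|x|x xcd].
  - by rewrite C2; exact: hne.
  - by rewrite C2; exact: hcd.
  - by rewrite addbC orientC oppr_eq0; exact: hab.
wlog cd : c d / c.2 <= d.2.
  move=> H hne hcd hab; have [|/ltW dc] := leP c.2 d.2; first by move/H; apply.
  rewrite -parity4C; last by move=> x y xab ycd; apply: leN; exact: hne.
  rewrite -parity4_revl crossingC -crossing_revl crossingC parity4C; last first.
    by move=> x y xab; rewrite C2 => ycd; apply: leN; exact: hne.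
  apply: H => // [x y xab|x xab|x].
  - by rewrite C2; exact: hne.
  - by rewrite addbC orientC oppr_eq0; exact: hcd.
  - by rewrite C2; exact: hab.
move=> hne hcd hab.
have ac : a.2 != c.2 by apply: hne; rewrite inE eqxx.
have [h|h] : a.2 < c.2 \/ c.2 < a.2 by case: (ltgtP a.2 c.2) ac; [left|right|].
  exact: parity4_sorted.
rewrite -parity4C; last by move=> x y xab ycd; apply: leN; exact: hne.
rewrite crossingC; apply: parity4_sorted => // x y xab ycd.
by rewrite eq_sym; exact: hne.
Qed.

(** Heights are compared lexicographically, i.e. the rays are tilted
    infinitesimally, so that distinct points never have the same height. *)
Definition lep p q := (p.2 < q.2) || (p.2 == q.2) && (p.1 <= q.1).

Lemma lepN x y : x != y -> lep y x = ~~ lep x y.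
Proof.
case: x y => [x1 x2] [y1 y2]; rewrite /lep xpair_eqE /=.
case: (ltgtP x2 y2) => [//|//|_]; rewrite andbT /= -ltNge lt_neqAle eq_sym.
by move=> ->.
Qed.

Let shear (e : R) p : plane R := (p.1, p.2 + e * p.1).

(** Every small enough shear realizes the infinitesimal tilt. The 1 in the denominator of the bound
    keeps it nonzero for points on a vertical line. *)
Lemma lep_shear p q : exists2 d : R, 0 < d &
  forall e, 0 < e < d -> lep p q = le2 (shear e p) (shear e q).
Proof.
rewrite /lep /le2 /shear /=.
have n0 : 0 < 1 + `|q.1 - p.1| by rewrite ltr_wpDr.
have [h|h|->] := ltgtP p.2 q.2.
- exists ((q.2 - p.2) / (1 + `|q.1 - p.1|)); first by apply: divr_gt0; [lra|].
  move=> e /andP[e0]; rewrite ltr_pdivlMr // => he.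
  have : - (q.1 - p.1) <= `|q.1 - p.1| by rewrite -normrN ler_norm.
  by move=> ?; apply/esym; nra.
- exists ((p.2 - q.2) / (1 + `|q.1 - p.1|)); first by apply: divr_gt0; [lra|].
  move=> e /andP[e0]; rewrite ltr_pdivlMr // => he.
  have : (q.1 - p.1) <= `|q.1 - p.1| by rewrite ler_norm.
  by move=> ?; apply/esym/negbTE; rewrite -ltNge; nra.
- exists 1 => // e /andP[e0 _] /=.
  by rewrite lerD2l ler_pM2l.
Qed.

Lemma lep_shear_seq (s : seq (plane R * plane R)) : exists2 d : R, 0 < d &
  forall e, 0 < e < d -> forall z, z \in s ->
    lep z.1 z.2 = le2 (shear e z.1) (shear e z.2).
Proof.
elim: s => [|z s [d d0 IH]]; first by exists 1.
have [d' d'0 h] := lep_shear z.1 z.2.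
exists (Num.min d d'); first by rewrite lt_min d0.
move=> e /andP[e0]; rewrite lt_min => /andP[ed ed'] y.
rewrite inE => /predU1P[->|]; first by apply: h; rewrite e0.
by apply: IH; rewrite e0.
Qed.

Lemma orient_shear e a b c : orient (shear e a) (shear e b) (shear e c) = orient a b c.
Proof. by rewrite /orient /shear /=; ring. Qed.

(** The sheared height is affine along the line [a b], so a point of this line whose height is
    between those of [a] and [b] has its parameter in [0, 1]. *)
Lemma between_orient e a b c : le2 (shear e a) (shear e c) (+) le2 (shear e b) (shear e c) ->
  ~ seg a b c -> orient a b c != 0.
Proof.
move=> h n; apply/eqP => o0; apply: n; move: h o0.
have [->|ab] := eqVneq a b; first by rewrite addbb.
move=> + /(orient0_comb ab)[t ec]; exists t => //; move: h.
rewrite ec combE /le2 /shear /=.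
have -> : (1 - t) * a.2 + t * b.2 + e * ((1 - t) * a.1 + t * b.1) =
  (1 - t) * (a.2 + e * a.1) + t * (b.2 + e * b.1) :> R by ring.
move: (a.2 + e * a.1 : R) (b.2 + e * b.1 : R) => u v.
have [h1|h1] := leP u _; have [h2|h2] := leP v _ => //= _.
  have vu : u < v by lra.
  have : 0 <= t * (v - u) by lra.
  have : 0 <= (1 - t) * (v - u) by lra.
  by rewrite !pmulr_lge0 ?subr_gt0 //; lra.
have vu : v < u by lra.
have : 0 <= t * (u - v) by lra.
have : 0 <= (1 - t) * (u - v) by lra.
by rewrite !pmulr_lge0 ?subr_gt0 //; lra.
Qed.

(** A shear small enough for all comparisons among the four points removes the ties between the
    segments and preserves orientations, so the case of plain heights applies. *)
Lemma parity4_crossing a b c d : generic a b c d ->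
  parity4 lep a b c d = crossing a b c d.
Proof.
case=> ga gb gc gd.
have [e0 e00 he] := lep_shear_seq
  [seq (x, y) | x <- [:: a; b; c; d], y <- [:: a; b; c; d]].
pose e := e0 / 2%:R; have {he} he x y : x \in [:: a; b; c; d] -> y \in [:: a; b; c; d] ->
    lep x y = le2 (shear e x) (shear e y).
  by move=> xs ys; apply: (he e _ (x, y)); [rewrite /e; lra|exact: allpairs_f].
have -> : parity4 lep a b c d =
    parity4 (@le2 R) (shear e a) (shear e b) (shear e c) (shear e d).
  by rewrite /parity4 !orient_shear -!he // !inE eqxx ?orbT.
have -> : crossing a b c d = crossing (shear e a) (shear e b) (shear e c) (shear e d).
  by rewrite /crossing !orient_shear.
have he2 x y : x \in [:: a; b; c; d] -> y \in [:: a; b; c; d] -> x != y ->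
    (shear e x).2 != (shear e y).2.
  move=> xs ys /lepN; rewrite (he _ _ ys xs) (he _ _ xs ys) /le2 => h.
  by apply/eqP => h'; move: h; rewrite h' lexx.
have sab x : x \in [:: shear e a; shear e b] -> exists2 y, y \in [:: a; b] & x = shear e y.
  by rewrite !inE => /pred2P[]->; [exists a|exists b]; rewrite // !inE eqxx ?orbT.
have scd x : x \in [:: shear e c; shear e d] -> exists2 y, y \in [:: c; d] & x = shear e y.
  by rewrite !inE => /pred2P[]->; [exists c|exists d]; rewrite // !inE eqxx ?orbT.
apply: parity4_le2.
- move=> _ _ /sab[x xab ->] /scd[y ycd ->]; apply: he2.
  + by move: xab; rewrite !inE => /pred2P[]->; rewrite eqxx ?orbT.
  + by move: ycd; rewrite !inE => /pred2P[]->; rewrite eqxx ?orbT.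
  apply/eqP => exy; move: xab ycd; rewrite -exy !inE => /pred2P[]-> /pred2P[] e'.
  + by apply: gc; rewrite -e'; exact: seg_left.
  + by apply: gd; rewrite -e'; exact: seg_left.
  + by apply: gc; rewrite -e'; exact: seg_right.
  + by apply: gd; rewrite -e'; exact: seg_right.
- move=> _ /sab[x xab ->] /between_orient h; rewrite orient_shear; apply: h.
  by move: xab; rewrite !inE => /pred2P[]->.
- move=> _ /scd[x xcd ->] /between_orient h; rewrite orient_shear; apply: h.
  by move: xcd; rewrite !inE => /pred2P[]->.
Qed.
End LexicographicHeight.

(** The booleans are the field of two elements, so identities between parities are left to [ring] in
    characteristic 2. *)
Lemma addbE (x y : bool) : x (+) y = (x + y)%R. Proof. by []. Qed.

Lemma char2 : 2%:R = 0 :> bool. Proof. by []. Qed.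

Ltac bool_ring :=
  rewrite ?addbE; rewrite ?[in RHS](erefl : false = 0 :> bool); ring: char2.

(** * The crossing formula for polylines *)

Section Polylines.
Variable R : realType.
Implicit Types (a b c d p q x y : plane R) (s t : seq (plane R)).

Definition ray a b c := upward_left (lep a c) (lep b c) (orient a b c).

Lemma ray_sym a b c : ray b a c = ray a b c.
Proof. by rewrite /ray orientC upward_leftC. Qed.

Lemma ray_refl a c : ray a a c = false.
Proof. by rewrite /ray /upward_left addbb. Qed.

(** For [p] inside the segment, the orientations of both pieces are positive multiples of that of
    the whole, and by convexity [p] is above or below [c] whenever both ends are. As [lep] is
    half-open, a ray through [p] is counted in one piece only. *)
Lemma ray_split a b p c : seg a b p -> ray a b c = ray a p c (+) ray p b c.
Proof.
case=> t /andP[t0 t1] ep.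
have [t00|tn0] := eqVneq t 0.
  by rewrite ep t00 subr0 scale1r scale0r addr0 ray_refl.
have [t11|tn1] := eqVneq t 1.
  by rewrite ep t11 subrr scale1r scale0r add0r ray_refl addbF.
have {t0 tn0} t0 : 0 < t by rewrite lt_neqAle eq_sym tn0.
have {t1 tn1} t1 : 0 < 1 - t by rewrite subr_gt0 lt_neqAle tn1.
have o1 : orient a p c = t * orient a b c by rewrite ep combE /orient /=; ring.
have o2 : orient p b c = (1 - t) * orient a b c by rewrite ep combE /orient /=; ring.
rewrite /ray /upward_left o1 o2 !pmulr_rgt0 // !pmulr_rlt0 //.
suff [H1 H2] : (lep a c && lep b c -> lep p c) /\ (~~ lep a c && ~~ lep b c -> ~~ lep p c).
  by move: H1 H2; case: (lep a c) (lep b c) (lep p c) => [] [] [] //= H1 H2;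
     rewrite ?addbF ?addFb //; by [have := H1 isT | have := H2 isT].
have e1 : c.1 - p.1 = (1 - t) * (c.1 - a.1) + t * (c.1 - b.1) by rewrite ep combE /=; ring.
have e2 : c.2 - p.2 = (1 - t) * (c.2 - a.2) + t * (c.2 - b.2) by rewrite ep combE /=; ring.
rewrite /lep; split=> [/andP[/orP ha /orP hb]|].
  have {}ha : a.2 < c.2 \/ a.2 = c.2 /\ a.1 <= c.1.
    by case: ha => [|/andP[/eqP]]; [left|right].
  have {}hb : b.2 < c.2 \/ b.2 = c.2 /\ b.1 <= c.1.
    by case: hb => [|/andP[/eqP]]; [left|right].
  case: ha => [ha|[ha ha']]; case: hb => [hb|[hb hb']].
  - have -> // : p.2 < c.2 by nra.
  - have -> // : p.2 < c.2 by nra.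
  - have -> // : p.2 < c.2 by nra.
  - have -> : p.2 = c.2 by rewrite -ha; nra.
    by rewrite eqxx /= orbC; have -> : p.1 <= c.1 by nra.
rewrite !negb_or !negb_and -!leNgt -!ltNge => /andP[/andP[a1 /orP a2] /andP[b1 /orP b2]].
have {a1 a2}ha : c.2 < a.2 \/ a.2 = c.2 /\ c.1 < a.1.
  by case: (ltgtP a.2 c.2) a1 a2 => [//|h _ _|h _ []//]; [left|right].
have {b1 b2}hb : c.2 < b.2 \/ b.2 = c.2 /\ c.1 < b.1.
  by case: (ltgtP b.2 c.2) b1 b2 => [//|h _ _|h _ []//]; [left|right].
case: ha => [ha|[ha ha']]; case: hb => [hb|[hb hb']].
- have h : c.2 < p.2 by nra.
  by rewrite (ltW h) gt_eqF.
- have h : c.2 < p.2 by nra.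
  by rewrite (ltW h) gt_eqF.
- have h : c.2 < p.2 by nra.
  by rewrite (ltW h) gt_eqF.
- have -> : p.2 = c.2 by rewrite -ha; nra.
  by rewrite lexx eqxx /=; nra.
Qed.

(** The start is kept apart from the other vertices, so that a single point is a polyline too,
    unlike in [pl_curve]. *)
Fixpoint trace a s : set (plane R) :=
  if s is b :: s' then seg a b `|` trace b s' else [set a].

Lemma trace_head a s : trace a s a.
Proof. by case: s => //= b s; left; exact: seg_left. Qed.

Lemma trace_last a s : trace a s (last a s).
Proof. by elim: s a => //= b s IH a; right. Qed.

Lemma trace_cat a s t : trace a (s ++ t) = trace a s `|` trace (last a s) t.
Proof.
elim: s a => [|b s IH] a /=; last by rewrite IH setUA.
apply/seteqP; split=> x; first by right.
by case=> [->|//]; exact: trace_head.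
Qed.

Lemma trace_rev a s : trace (last a s) (rev (belast a s)) = trace a s.
Proof.
elim: s a => //= b s IH a; rewrite rev_cons -cats1 trace_cat IH.
have -> : last (last b s) (rev (belast b s)) = b.
  by case: s {IH} => //= c s; rewrite rev_cons last_rcons.
rewrite /= seg_sym; apply/seteqP; split=> x.
  by case=> [|[]]; [right|left|move=> ->; left; exact: seg_left].
by case; [right; left|left].
Qed.

Fixpoint ray_parity a s c : bool :=
  if s is b :: s' then ray a b c (+) ray_parity b s' c else false.

Lemma ray_parity_cat a s t c :
  ray_parity a (s ++ t) c = ray_parity a s c (+) ray_parity (last a s) t c.
Proof. by elim: s a => //= b s IH a; rewrite IH addbA. Qed.

Lemma ray_parity_rev a s c :
  ray_parity (last a s) (rev (belast a s)) c = ray_parity a s c.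
Proof.
elim: s a => //= b s IH a; rewrite rev_cons -cats1 ray_parity_cat IH.
have -> : last (last b s) (rev (belast b s)) = b.
  by case: s {IH} => //= d s; rewrite rev_cons last_rcons.
by rewrite /= ray_sym addbF addbC.
Qed.

(** Exactly one of [x], [y] is between [a] and [b] in height. *)
Definition interlace x y a b := lep x a (+) lep x b (+) lep y a (+) lep y b.

(** Additive under concatenation of polylines even when they are not in general
    position; the parity of the number of crossings only when they are. *)
Definition crossing_parity a s c t :=
  ray_parity c t a (+) ray_parity c t (last a s) (+)
  ray_parity a s c (+) ray_parity a s (last c t) (+)
  interlace a (last a s) c (last c t).

Lemma crossing_parity_cat a s1 s2 c t : crossing_parity a (s1 ++ s2) c t =
  crossing_parity a s1 c t (+) crossing_parity (last a s1) s2 c t.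
Proof.
rewrite /crossing_parity /interlace !ray_parity_cat last_cat; bool_ring.
Qed.

Lemma crossing_parity_nil a c t : crossing_parity a [::] c t = false.
Proof. by rewrite /crossing_parity /interlace /= ?addbF; bool_ring. Qed.

Lemma crossing_parity_nilr a s c : crossing_parity a s c [::] = false.
Proof. by rewrite /crossing_parity /interlace /= ?addbF; bool_ring. Qed.

Lemma crossing_parity_catr a s c t1 t2 : crossing_parity a s c (t1 ++ t2) =
  crossing_parity a s c t1 (+) crossing_parity a s (last c t1) t2.
Proof.
by rewrite /crossing_parity /interlace !ray_parity_cat last_cat; bool_ring.
Qed.

(** Each ray term occurs twice and the comparison of heights four times. *)
Lemma crossing_parity_closed a s c t :
  last a s = a -> last c t = c -> crossing_parity a s c t = false.
Proof.
by move=> ea ec; rewrite /crossing_parity /interlace ea ec; 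
   do 2!case: (ray_parity _ _ _); case: lep.
Qed.

Lemma crossing_parity1 a b c d :
  crossing_parity a [:: b] c [:: d] = parity4 (@lep R) a b c d.
Proof. by rewrite /crossing_parity /parity4 /ray /= !addbF. Qed.

(** Additivity in both arguments reduces this to pairs of segments. Disjoint segments are generic,
    so the formula counts their crossings. *)
Lemma crossing_parity_disjoint a s c t :
  trace a s `&` trace c t = set0 -> crossing_parity a s c t = false.
Proof.
elim: s a => [|b s IHs] a; first by rewrite crossing_parity_nil.
rewrite -(cat1s b) crossing_parity_cat trace_cat setIUl setU_eq0 => -[h1 /IHs ->].
rewrite addbF; elim: t c h1 {IHs} => [|d t IHt] c; first by rewrite crossing_parity_nilr.
rewrite -(cat1s d) crossing_parity_catr trace_cat setIUr setU_eq0 => -[h /IHt ->].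
rewrite addbF crossing_parity1.
have dis p : seg a b p -> seg c d p -> False.
  by move=> h1 h2; have : set0 p by rewrite -h; split; left.
rewrite parity4_crossing.
  by apply/negbTE/negP => /crossing_meet[p h1 h2]; exact: (dis p).
by split=> h'; apply: dis; try exact: h'; (exact: seg_left || exact: seg_right).
Qed.

End Polylines.

(** * Ends of strings and the nonplanarity of K_{3,3} *)

Section Connection.
Variable R : realType.
Implicit Types (a b c d p q x y : plane R) (s t : seq (plane R)) (S T : set (plane R)).

Definition pl_joined S x y := exists2 s, last x s = y & trace x s `<=` S.

Lemma pl_joined_refl S x : S x -> pl_joined S x x.
Proof. by move=> Sx; exists [::] => // ? ->. Qed.

Lemma pl_joined_trans S x y z : pl_joined S x y -> pl_joined S y z -> pl_joined S x z.
Proof.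
move=> [s <- hs] [t <- ht]; exists (s ++ t); first by rewrite last_cat.
by rewrite trace_cat => q [/hs|/ht].
Qed.

Lemma pl_joined_sym S x y : pl_joined S x y -> pl_joined S y x.
Proof.
move=> [s <- hs]; exists (rev (belast x s)); last by rewrite trace_rev.
by case: s {hs} => //= d s; rewrite rev_cons last_rcons.
Qed.

Lemma pl_joined_sub S T x y : S `<=` T -> pl_joined S x y -> pl_joined T x y.
Proof. by move=> ST [s e hs]; exists s => // q /hs /ST. Qed.

Lemma pl_joined_mem S x y : pl_joined S x y -> S x /\ S y.
Proof. by move=> [s <- hs]; split; apply: hs; [exact: trace_head|exact: trace_last]. Qed.

Lemma pl_joined_seg S x y : seg x y `<=` S -> pl_joined S x y.
Proof.
move=> h; exists [:: y] => //= q [/h //|->]; apply: h; exact: seg_right.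
Qed.

Lemma seg_sub a b p q : seg a b p -> seg a b q -> seg p q `<=` seg a b.
Proof.
move=> [t ht ->] [u hu ->] _ [v hv ->]; exists ((1 - v) * t + v * u).
  by apply/andP; split; nra.
by rewrite comb_comb.
Qed.

Lemma trace_joined a s q : trace a s q -> pl_joined (trace a s) a q.
Proof.
elim: s a => [|b s IH] a /=; first by move=> ->; exact: pl_joined_refl.
case=> [abq|/IH bq].
  apply: pl_joined_seg => z hz; left.
  exact: (seg_sub (seg_left a b) abq).
apply: (@pl_joined_trans _ _ b).
  by apply: pl_joined_seg => z; left.
by apply: pl_joined_sub bq => z; right.
Qed.

(** The l1 distance grows linearly along a segment from [a] and involves no square root. *)
Let dist a q : R := `|q.1 - a.1| + `|q.2 - a.2|.

Lemma dist_seg a p q : seg a p q -> dist a p <= dist a q -> q = p.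
Proof.
move=> [t /andP[t0 t1] ->]; rewrite combE /dist /=.
have -> : (1 - t) * a.1 + t * p.1 - a.1 = t * (p.1 - a.1) by ring.
have -> : (1 - t) * a.2 + t * p.2 - a.2 = t * (p.2 - a.2) by ring.
rewrite !normrM (ger0_norm t0) -mulrDr; set k := _ + _ => h.
have [->|tn1] := eqVneq t 1; first by rewrite subrr !mul0r !mul1r !add0r -surjective_pairing.
have {}t1 : t < 1 by rewrite lt_neqAle tn1.
have n1 := normr_ge0 (p.1 - a.1); have n2 := normr_ge0 (p.2 - a.2).
have k0 : k = 0 by rewrite /k in h *; nra.
have z1 : p.1 - a.1 = 0 by apply/eqP; rewrite -normr_le0; rewrite /k in k0; lra.
have z2 : p.2 - a.2 = 0 by apply/eqP; rewrite -normr_le0; rewrite /k in k0; lra.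
rewrite [p in RHS]surjective_pairing.
have -> : a.1 = p.1 by lra.
have -> : a.2 = p.2 by lra.
by congr (_, _); ring.
Qed.

Lemma finite_argmin (A : set (plane R)) (f : plane R -> R) :
  finite_set A -> A !=set0 -> exists2 x, A x & forall y, A y -> f x <= f y.
Proof.
move=> /finite_seqP[l ->] [x0 /= x0l].
have : exists2 x, x \in l & all (fun y => f x <= f y) l.
  elim: l x0 x0l => // z l IH x0 _; case: l IH => [|z' l] IH.
    by exists z; rewrite ?mem_head //= lexx.
  have [x xl /allP h] := IH z' (mem_head _ _).
  have [zx|xz] := leP (f z) (f x).
    exists z; first exact: mem_head.
    apply/allP => y; rewrite inE => /predU1P[->//|/h]; exact: le_trans.
  exists x; first by rewrite inE xl orbT.
  by apply/allP => y; rewrite inE => /predU1P[->|/h //]; exact: ltW.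
by case=> x xl /allP h; exists x.
Qed.

(** [p] is the point of [S] on the segment nearest to [a], which exists by finiteness. *)
Lemma seg_first_hit S a b : finite_set (seg a b `&` S) -> seg a b `&` S !=set0 ->
  exists p, [/\ seg a b p, S p & forall q, seg a p q -> q <> p -> pl_joined (seg a b `\` S) a q].
Proof.
move=> fin ne; have [p [abp Sp] hp] := finite_argmin (dist a) fin ne.
exists p; split=> // q apq qp; apply: pl_joined_seg => z aqz.
have apz : seg a p z by exact: (seg_sub (seg_left _ _) apq).
have abz : seg a b z by exact: (seg_sub (seg_left _ _) abp).
split=> // Sz; have zp : z = p by apply: (dist_seg apz); apply: hp; split.
apply: qp; apply: (dist_seg apq); rewrite -zp; move: aqz => [t /andP[t0 t1] ->].
rewrite combE /dist /=.
have -> : (1 - t) * a.1 + t * q.1 - a.1 = t * (q.1 - a.1) by ring.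
have -> : (1 - t) * a.2 + t * q.2 - a.2 = t * (q.2 - a.2) by ring.
have n1 := normr_ge0 (q.1 - a.1); have n2 := normr_ge0 (q.2 - a.2).
by rewrite !normrM (ger0_norm t0); apply: lerD; nra.
Qed.

(** The cut point may be inside a segment, so the pieces are related to [s] by their ray parities
    and not by concatenation. *)
Lemma trace_first_hit S a s : finite_set (trace a s `&` S) -> trace a s `&` S !=set0 ->
  exists s1 p s2, [/\ last a s1 = p, S p, last p s2 = last a s,
    trace a s1 `<=` trace a s /\ trace p s2 `<=` trace a s &
    (forall c, ray_parity a s c = ray_parity a s1 c (+) ray_parity p s2 c) /\
    (forall q, trace a s1 q -> q <> p -> pl_joined (trace a s `\` S) a q)].
Proof.
elim: s a => [|b s IH] a fin ne.
  case: ne => p [-> Sa]; exists [::], a, [::]; split=> //; split=> // q -> //.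
have [hab|nab] := pselect (seg a b `&` S !=set0).
  have fab : finite_set (seg a b `&` S).
    by apply: sub_finite_set fin => q [h1 h2]; split=> //; left.
  have [p [abp Sp hp]] := seg_first_hit fab hab.
  exists [:: p], p, (b :: s); split=> //.
    split=> q /=; last first.
      by case=> h; [left; exact: (seg_sub abp (seg_right _ _))|right].
    by case=> [h|->]; left=> //; exact: (seg_sub (seg_left _ _) abp).
  split=> [c|q /=]; first by rewrite /= addbF (ray_split c abp) addbA.
  move=> [h|->] // qp; apply: pl_joined_sub (hp q h qp) => z [h1 h2]; split=> //.
  by left.
have {nab}nab z : seg a b z -> ~ S z by move=> h1 h2; apply: nab; exists z.
have fb : finite_set (trace b s `&` S).
  by apply: sub_finite_set fin => q [h1 h2]; split=> //; right.
have nb : trace b s `&` S !=set0.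
  by case: ne => z [[/nab//|h1] h2]; exists z.
have [s1 [p [s2 [e1 Sp e2 [h1 h2] [h3 h4]]]]] := IH b fb nb.
exists (b :: s1), p, s2; split=> //.
  split=> q /=; first by case=> [|/h1]; [left|right].
  by move/h2; right.
split=> [c|q /=]; first by rewrite /= h3 addbA.
move=> [h|h] qp.
  apply: pl_joined_seg => z hz.
  have abz : seg a b z by exact: (seg_sub (seg_left _ _) h).
  by split; [left|exact: nab].
apply: (@pl_joined_trans _ _ b).
  by apply: pl_joined_seg => z abz; split; [left|exact: nab].
by apply: pl_joined_sub (h4 q h qp) => z [z1 z2]; split=> //; right.
Qed.

End Connection.

(** * End pieces cut off by a set *)

Section Tails.
Variable R : realType.
Implicit Types (a b c d p q x y : plane R) (s t : seq (plane R)) (S T : set (plane R)).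

Lemma last_rev_belast a s : last (last a s) (rev (belast a s)) = a.
Proof. by case: s => //= d s; rewrite rev_cons last_rcons. Qed.

(** The first hit is taken from the start and then, on the remaining piece, from the far end. [p1]
    and [p2] may coincide. *)
Lemma trace_hits S a s : finite_set (trace a s `&` S) -> trace a s `&` S !=set0 ->
  exists s1 p1 m p2 s2, [/\
    [/\ last a s1 = p1, last p1 m = p2, last p2 s2 = last a s, S p1 & S p2],
    [/\ trace a s1 `<=` trace a s, trace p1 m `<=` trace a s & trace p2 s2 `<=` trace a s],
    (forall c, ray_parity a s c =
       ray_parity a s1 c (+) ray_parity p1 m c (+) ray_parity p2 s2 c),
    (forall q, trace a s1 q -> q <> p1 -> pl_joined (trace a s `\` S) a q) &
    (forall q, trace p2 s2 q -> q <> p2 -> pl_joined (trace a s `\` S) (last a s) q)].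
Proof.
move=> fin ne.
have [s1 [p1 [r [e1 Sp1 e2 [h1 h2] [h3 h4]]]]] := trace_first_hit fin ne.
have fin' : finite_set (trace (last p1 r) (rev (belast p1 r)) `&` S).
  by rewrite trace_rev; apply: sub_finite_set fin => q [/h2].
have ne' : trace (last p1 r) (rev (belast p1 r)) `&` S !=set0.
  by rewrite trace_rev; exists p1; split=> //; exact: trace_head.
have [r1 [p2 [r2 [e3 Sp2 e4 [h5 h6] [h7 h8]]]]] := trace_first_hit fin' ne'.
rewrite trace_rev last_rev_belast in h5 h6 h8 e4.
exists s1, p1, (rev (belast p2 r2)), p2, (rev (belast (last p1 r) r1)).
split.
- by split=> //; [rewrite -e4 last_rev_belast|rewrite -e3 last_rev_belast].
- split=> //; first by rewrite -e4 trace_rev => q /h6 /h2.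
  by rewrite -e3 trace_rev => q /h5 /h2.
- move=> c; rewrite h3 -(ray_parity_rev p1 r) h7 -addbA; congr (_ (+) _).
  by rewrite addbC -(ray_parity_rev p2 r2) -(ray_parity_rev (last p1 r) r1) e3 e4.
- exact: h4.
- rewrite -[p2 in trace p2]e3 trace_rev -e2 => q hq qp.
  by apply: pl_joined_sub (h8 q hq qp) => z [/h2].
Qed.

Lemma crossing_parity_split a s s1 m s2 c t :
  let p1 := last a s1 in let p2 := last p1 m in last p2 s2 = last a s ->
  (forall c, ray_parity a s c =
     ray_parity a s1 c (+) ray_parity p1 m c (+) ray_parity p2 s2 c) ->
  crossing_parity a s c t = crossing_parity a s1 c t (+)
    crossing_parity p1 m c t (+) crossing_parity p2 s2 c t.
Proof.
move=> p1 p2 e h; rewrite /crossing_parity /interlace !h e -/p1 -/p2; bool_ring.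
Qed.

Lemma crossing_parity_split_r a s s1 m s2 c t :
  let p1 := last a s1 in let p2 := last p1 m in last p2 s2 = last a s ->
  (forall c, ray_parity a s c =
     ray_parity a s1 c (+) ray_parity p1 m c (+) ray_parity p2 s2 c) ->
  crossing_parity c t a s = crossing_parity c t a s1 (+)
    crossing_parity c t p1 m (+) crossing_parity c t p2 s2.
Proof.
move=> p1 p2 e h; rewrite /crossing_parity /interlace !h e -/p1 -/p2; bool_ring.
Qed.

(** The polylines are closed up inside [S] and [T]. The closed polylines have even parity, and the
    three contributions of the closing paths vanish by disjointness. *)
Lemma inner_parity S T p1 m q1 n : S p1 -> S (last p1 m) -> T q1 -> T (last q1 n) ->
  (forall x y, S x -> S y -> pl_joined S x y) ->
  (forall x y, T x -> T y -> pl_joined T x y) ->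
  trace p1 m `&` T = set0 -> S `&` trace q1 n = set0 -> S `&` T = set0 ->
  crossing_parity p1 m q1 n = false.
Proof.
move=> Sp1 Sp2 Tq1 Tq2 jS jT mT Sn ST.
have [k ek kS] := jS _ _ Sp2 Sp1; have [l el lT] := jT _ _ Tq2 Tq1.
have := @crossing_parity_closed _ p1 (m ++ k) q1 (n ++ l).
rewrite !last_cat => /(_ ek el); rewrite crossing_parity_cat !crossing_parity_catr.
have sub0 (A B A' B' : set (plane R)) : A `&` B = set0 ->
    A' `<=` A -> B' `<=` B -> A' `&` B' = set0.
  by move=> AB AA BB; rewrite -subset0 -AB => z [/AA ? /BB].
rewrite [crossing_parity p1 m _ l]crossing_parity_disjoint; last exact: sub0 mT _ lT.
rewrite [crossing_parity _ k q1 n]crossing_parity_disjoint; last exact: sub0 Sn kS _.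
rewrite [crossing_parity _ k _ l]crossing_parity_disjoint; last exact: sub0 ST kS lT.
by rewrite !addbF.
Qed.

Definition tail_meets a s S B :=
  exists2 q, B q & pl_joined (trace a s `\` S) a q \/ pl_joined (trace a s `\` S) (last a s) q.

(** If no end piece of one polyline meets the other polyline, the parities involving an end piece
    vanish, and that of the two middle pieces vanishes by [inner_parity]. *)
Lemma odd_crossing_tail a s c t S T :
  finite_set (trace a s `&` S) -> trace a s `&` S !=set0 ->
  finite_set (trace c t `&` T) -> trace c t `&` T !=set0 ->
  (forall x y, S x -> S y -> pl_joined S x y) ->
  (forall x y, T x -> T y -> pl_joined T x y) ->
  trace a s `&` T = set0 -> S `&` trace c t = set0 -> S `&` T = set0 ->
  crossing_parity a s c t ->
  tail_meets a s S (trace c t) \/ tail_meets c t T (trace a s).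
Proof.
move=> fS nS fT nT jS jT sT St ST; apply: contraPP => /not_orP[ns nt].
have [s1 [p1 [m [p2 [s2 [[e1 e2 e3 Sp1 Sp2] [i1 i2 i3] ps js1 js2]]]]]] := trace_hits fS nS.
have [t1 [q1 [n [q2 [t2 [[f1 f2 f3 Tq1 Tq2] [k1 k2 k3] pt jt1 jt2]]]]]] := trace_hits fT nT.
(* The cut point [p1] is in [S], which the other polyline avoids; the same remark settles the cut
   points below. *)
have n1 : trace a s1 `&` trace c t = set0.
  rewrite -subset0 => q [q1' q2']; apply: ns; exists q => //; left; apply: js1 => // qp.
  by have : set0 q by rewrite -St; split=> //; rewrite qp.
have n2 : trace p2 s2 `&` trace c t = set0.
  rewrite -subset0 => q [q1' q2']; apply: ns; exists q => //; right; apply: js2 => // qp.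
  by have : set0 q by rewrite -St; split=> //; rewrite qp.
have n3 : trace p1 m `&` trace c t1 = set0.
  rewrite -subset0 => q [/i2 q1' q2']; apply: nt; exists q => //; left; apply: jt1 => // qp.
  by have : set0 q by rewrite -sT; split=> //; rewrite qp.
have n4 : trace p1 m `&` trace q2 t2 = set0.
  rewrite -subset0 => q [/i2 q1' q2']; apply: nt; exists q => //; right; apply: jt2 => // qp.
  by have : set0 q by rewrite -sT; split=> //; rewrite qp.
rewrite (@crossing_parity_split a s s1 m s2) e1 ?e2 //.
rewrite (crossing_parity_disjoint n1) (crossing_parity_disjoint n2) addbF addFb.
rewrite (@crossing_parity_split_r c t t1 n t2) f1 ?f2 //.
rewrite (crossing_parity_disjoint n3) (crossing_parity_disjoint n4) addbF addFb.
rewrite (@inner_parity S T) ?e2 ?f2 //.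
  by rewrite -subset0 -sT => z [/i2 ? ?].
by rewrite -subset0 -St => z [? /k2].
Qed.

End Tails.

(** * Nonplanarity of K_{3,3} *)

Section K33.
Variable R : realType.
Implicit Types (p q : plane R) (S : 'I_3 -> 'I_3 -> set (plane R)).

Lemma no_K33_polylines (P Q : 'I_3 -> plane R) (s : 'I_3 -> 'I_3 -> seq (plane R)) :
  (forall i j, last (P i) (s i j) = Q j) ->
  (forall i i' j j', i != i' -> j != j' ->
     trace (P i) (s i j) `&` trace (P i') (s i' j') = set0) ->
  False.
Proof.
move=> Qs dis.
have memQ i j : trace (P i) (s i j) (Q j) by rewrite -(Qs i j); exact: trace_last.
have neQ j j' : j != j' -> Q j != Q j'.
  move=> jj; apply/eqP => e; have : set0 (Q j); last by [].
  by rewrite -(dis 0 1 j j') //; split=> //; rewrite e.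
pose r i j := ray_parity (P i) (s i j).
have E i i' j j' : i != i' -> j != j' ->
    r i' j' (P i) (+) r i' j' (Q j) (+) r i j (P i') (+) r i j (Q j') (+)
    (lep (P i) (P i') (+) lep (P i) (Q j') (+) lep (Q j) (P i') (+) lep (Q j) (Q j')) = 0.
  move=> ii jj; have := crossing_parity_disjoint (dis _ _ _ _ ii jj).
  by rewrite /crossing_parity /interlace !Qs.
(* The sum of [E] for the two ways of pairing [i], [i'] with [j], [j']: [lep (P i) (P i')] cancels,
   while [lep (Q j) (Q j')] and its converse add up to 1. *)
have F i i' j j' : i != i' -> j != j' ->
    r i' j' (P i) + r i' j (P i) + r i j (P i') + r i j' (P i') +
    (lep (P i) (Q j') + lep (P i) (Q j)) + (lep (Q j) (P i') + lep (Q j') (P i')) +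
    (r i' j' (Q j) + r i' j (Q j') + r i j (Q j') + r i j' (Q j)) = 1.
  move=> ii jj; have E1 := E i i' j j' ii jj.
  have := E i i' j' j ii; rewrite eq_sym jj => /(_ isT) E2.
  have E3 : lep (Q j') (Q j) = 1 + lep (Q j) (Q j').
    by rewrite (lepN (neQ _ _ jj)) -addbE addTb.
  rewrite E3 in E2; rewrite -[RHS]addr0 -[X in _ = 1 + X]addr0 -{2}E1 -E2.
  bool_ring.
(* [G] below is inconsistent for three indices, as the sum of the three equations is 0 = 1. *)
pose g i := r i 0 (Q 1) + r i 1 (Q 0) + r i 0 (Q 2%:R) + r i 2%:R (Q 0) +
  r i 1 (Q 2%:R) + r i 2%:R (Q 1).
(* [F] is summed over the three pairs of indices [j], [j']. Each index is in two of the pairs, so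
   the rays at [P i], [P i'] and the comparisons of [P] with [Q] cancel. *)
have G i i' : i != i' -> g i + g i' = 1.
  move=> ii; have := (F i i' 0 1 ii isT, F i i' 0 2%:R ii isT, F i i' 1 2%:R ii isT).
  case=> [[E1 E2] E3]; rewrite /g -E1 -[LHS]addr0.
  have -> : 0 = (1 : bool) + 1 by [].
  rewrite -{1}E2 -E3; bool_ring.
have := (G 0 1 isT, G 0 2%:R isT, G 1 2%:R isT).
by case: (g 0) (g 1) (g 2%:R) => [] [] [] [[]].
Qed.

Lemma no_K33 (P Q : 'I_3 -> plane R) (S : 'I_3 -> 'I_3 -> set (plane R)) :
  (forall i j, pl_joined (S i j) (P i) (Q j)) ->
  (forall i i' j j', i != i' -> j != j' -> S i j `&` S i' j' = set0) ->
  False.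
Proof.
move=> hS dis.
have [s hs] : {s : 'I_3 -> 'I_3 -> seq (plane R) | forall i j,
    last (P i) (s i j) = Q j /\ trace (P i) (s i j) `<=` S i j}.
  apply: constructive_indefinite_description.
  have /choice[s hs] : forall ij : 'I_3 * 'I_3, exists s,
      last (P ij.1) s = Q ij.2 /\ trace (P ij.1) s `<=` S ij.1 ij.2.
    by move=> [i j]; have [s e h] := hS i j; exists s.
  by exists (fun i j => s (i, j)) => i j; exact: (hs (i, j)).
apply: (@no_K33_polylines P Q s) => [i j|i i' j j' ii jj]; first by case: (hs i j).
rewrite -subset0 -(dis i i' j j' ii jj) => z [h1 h2].
by split; [case: (hs i j) => _; apply|case: (hs i' j') => _; apply].
Qed.

End K33.

(** * The number of common points of two simple curves *)

Section CountCrossings.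
Variable R : realType.
Implicit Types (a b c d p q x y : plane R) (s t : seq (plane R)).

Lemma pl_curveP s p : pl_curve s p <->
  exists2 i, (i.+1 < size s)%N & seg (nth 0 s i) (nth 0 s i.+1) p.
Proof.
split; first by move=> [i [t [hi ht ->]]]; exists i => //; exists t.
by move=> [i hi [t ht ->]]; exists i, t.
Qed.

Lemma pl_curve_cons a b s : pl_curve [:: a, b & s] = seg a b `|` pl_curve (b :: s).
Proof.
apply/seteqP; split=> p.
  by move=> /pl_curveP[[|i] hi h]; [left|right; apply/pl_curveP; exists i].
case=> [h|/pl_curveP[i hi h]]; apply/pl_curveP; first by exists 0%N.
by exists i.+1.
Qed.

Lemma pl_curve_trace a b s : pl_curve [:: a, b & s] = trace a (b :: s).
Proof.
elim: s a b => [|c s IH] a b; last by rewrite pl_curve_cons IH.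
rewrite pl_curve_cons; apply/seteqP; split=> p [h|]; try by left.
  by move=> /pl_curveP[].
by move=> ->; left; exact: seg_right.
Qed.

Definition crossing_at s t i j :=
  crossing (nth 0 s i) (nth 0 s i.+1) (nth 0 t j) (nth 0 t j.+1).

Definition crossing_pairs s t :=
  [seq ij <- [seq (i, j) | i <- iota 0 (size s).-1, j <- iota 0 (size t).-1] |
    crossing_at s t ij.1 ij.2].

Lemma crossing_pairsP s t i j : reflect
  [/\ (i.+1 < size s)%N, (j.+1 < size t)%N & crossing_at s t i j]
  ((i, j) \in crossing_pairs s t).
Proof.
rewrite mem_filter /=; apply: (iffP andP).
  move=> [h /allpairsP[[i' j'] [/= hi hj [ei ej]]]]; subst i' j'.
  rewrite !mem_iota /= !add0n in hi hj.
  by split=> //; [case: (size s) hi|case: (size t) hj].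
move=> [hi hj h]; split=> //; apply: allpairs_f; rewrite mem_iota /= add0n.
  by case: (size s) hi.
by case: (size t) hj.
Qed.

Lemma crossing_pairs_uniq s t : uniq (crossing_pairs s t).
Proof.
by rewrite filter_uniq // allpairs_uniq ?iota_uniq // => -[? ?] [? ?].
Qed.

(** If [0 < t < 1] and [0 <= u <= 1], then [i + t = j + u] forces [i = j]. *)
Lemma pl_simple_interior s i j p : pl_simple s -> (i.+1 < size s)%N -> (j.+1 < size s)%N ->
  seg (nth 0 s i) (nth 0 s i.+1) p -> p != nth 0 s i -> p != nth 0 s i.+1 ->
  seg (nth 0 s j) (nth 0 s j.+1) p -> i = j.
Proof.
move=> simp hi hj [t ht et] p0 p1 [u hu eu].
have e := simp i j t u hi hj ht hu (etrans (esym et) eu).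
have t0 : t != 0 by apply: contra_neq p0 => t0; rewrite et t0 subr0 scale1r scale0r addr0.
have t1 : t != 1 by apply: contra_neq p1 => t1; rewrite et t1 subrr scale0r scale1r add0r.
have {}t0 : 0 < t by rewrite lt_neqAle eq_sym t0; lra.
have {}t1 : t < 1 by rewrite lt_neqAle t1; lra.
have [ij|ji|//] := ltngtP i j; exfalso.
  by have := ij; rewrite -(ler_nat R) -natr1; lra.
by have := ji; rewrite -(ler_nat R) -natr1; lra.
Qed.

Lemma crossing_point_neq a b c d p : crossing a b c d -> seg a b p -> seg c d p ->
  [/\ p != a, p != b, p != c & p != d].
Proof.
move=> h ab cd; have [h1 h2 h3 h4] := crossing_endpoint h.
by split; apply/eqP => e; rewrite e in ab cd; contradiction.
Qed.

(** Two crossing segments have exactly one common point. It is interior to both, so by simplicity it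
    determines the pair. *)
Lemma card_crossing_pairs s t : pl_simple s -> pl_simple t ->
  (forall i j p, (i.+1 < size s)%N -> (j.+1 < size t)%N ->
     seg (nth 0 s i) (nth 0 s i.+1) p -> seg (nth 0 t j) (nth 0 t j.+1) p ->
     crossing_at s t i j) ->
  pl_curve s `&` pl_curve t #= `I_(size (crossing_pairs s t)).
Proof.
move=> ss st H; set P := crossing_pairs s t.
have /choice[f hf] : forall ij : nat * nat, exists p, crossing_at s t ij.1 ij.2 ->
    seg (nth 0 s ij.1) (nth 0 s ij.1.+1) p /\ seg (nth 0 t ij.2) (nth 0 t ij.2.+1) p.
  move=> [i j] /=; case h : (crossing_at s t i j); last by exists 0.
  by have [p h1 h2] := crossing_meet h; exists p.
have -> : pl_curve s `&` pl_curve t = (fun k => f (nth (0, 0)%N P k)) @` `I_(size P).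
  apply/seteqP; split=> p.
    move=> [/pl_curveP[i hi h1] /pl_curveP[j hj h2]].
    have hc := H i j p hi hj h1 h2.
    have ijP : (i, j) \in P by apply/crossing_pairsP.
    exists (index (i, j) P); rewrite /= ?index_mem // nth_index //.
    have [h3 h4] := hf (i, j) hc.
    exact: crossing_uniq hc _ _ _ _.
  move=> [k /= kP <-]; case e : (nth _ P k) => [i j].
  have /crossing_pairsP[hi hj hc] : (i, j) \in P by rewrite -e mem_nth.
  by have [h1 h2] := hf (i, j) hc; split; apply/pl_curveP; [exists i|exists j].
apply: inj_card_eq => k l; rewrite !inE /= => kP lP.
case ek : (nth _ P k) => [i j]; case el : (nth _ P l) => [i' j'] e.
have /crossing_pairsP[hi hj hc] : (i, j) \in P by rewrite -ek mem_nth.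
have /crossing_pairsP[hi' hj' hc'] : (i', j') \in P by rewrite -el mem_nth.
have [h1 h2] := hf (i, j) hc; have [h1' h2'] := hf (i', j') hc'.
have [n1 n2 n3 n4] := crossing_point_neq hc h1 h2; rewrite /= -e in h1' h2'.
have ei := pl_simple_interior ss hi hi' h1 n1 n2 h1'.
have ej := pl_simple_interior st hj hj' h2 n3 n4 h2'.
by apply/eqP; rewrite -(nth_uniq (0, 0)%N kP lP (crossing_pairs_uniq s t)) ek el ei ej.
Qed.

Lemma crossing_parity_sum a s c t : crossing_parity a s c t =
  \big[addb/false]_(i <- iota 0 (size s)) \big[addb/false]_(j <- iota 0 (size t))
    parity4 (@lep R) (nth 0 (a :: s) i) (nth 0 (a :: s) i.+1)
      (nth 0 (c :: t) j) (nth 0 (c :: t) j.+1).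
Proof.
elim: s a => [|b s IHs] a; first by rewrite big_nil crossing_parity_nil.
rewrite -(cat1s b) crossing_parity_cat /= big_cons -add1n iotaDl big_map.
rewrite IHs; congr (_ (+) _); elim: t c {IHs} => [|d t IHt] c.
  by rewrite big_nil crossing_parity_nilr.
rewrite -(cat1s d) crossing_parity_catr /= big_cons -add1n iotaDl big_map.
by rewrite crossing_parity1 IHt.
Qed.

Lemma big_addb_odd (T : Type) (r : seq T) (f : T -> bool) :
  \big[addb/false]_(i <- r) f i = odd (count f r).
Proof. by elim: r => [|x r IH]; rewrite ?big_nil // big_cons IH /= oddD oddb. Qed.

(** Both sides are sums over pairs of segments; this links the formula to the actual number of
    crossings. *)
Lemma crossing_parity_odd a s c t :
  (forall i j, (i < size s)%N -> (j < size t)%N ->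
     generic (nth 0 (a :: s) i) (nth 0 (a :: s) i.+1)
       (nth 0 (c :: t) j) (nth 0 (c :: t) j.+1)) ->
  crossing_parity a s c t = odd (size (crossing_pairs (a :: s) (c :: t))).
Proof.
move=> gen; rewrite crossing_parity_sum size_filter -big_addb_odd.
rewrite big_allpairs; apply: eq_big_seq => i; rewrite mem_iota /= add0n => hi.
apply: eq_big_seq => j; rewrite mem_iota /= add0n => hj.
by rewrite parity4_crossing //; exact: gen.
Qed.

End CountCrossings.

(** * The graph *)

(** The neighbours in the pentagonal bipyramid in cyclic order; 5 and 6 are the
    poles. *)
Definition nbrs : seq (seq nat) :=
  [:: [:: 1; 5; 4; 6];
      [:: 6; 2; 5; 0];
      [:: 6; 3; 5; 1];
      [:: 6; 4; 5; 2];
      [:: 3; 6; 0; 5];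
      [:: 2; 3; 4; 0; 1];
      [:: 0; 4; 3; 2; 1]]%N.

(** The face between the neighbours number [k] and [k + 1] of [u], among the 10 faces
    of the bipyramid. *)
Definition corners : seq (seq nat) :=
  [:: [:: 0; 1; 2; 3];
      [:: 4; 5; 0; 3];
      [:: 6; 7; 5; 4];
      [:: 8; 9; 7; 6];
      [:: 8; 2; 1; 9];
      [:: 7; 9; 1; 0; 5];
      [:: 2; 8; 6; 4; 3]]%N.

Definition deg u := size (nth [::] nbrs u).
(** Indices are reduced modulo the degree, so that arcs may run past the end of the cyclic lists. *)
Definition nbr u k := nth 0%N (nth [::] nbrs u) (k %% deg u).
Definition corner u k := nth 0%N (nth [::] corners u) (k %% deg u).

(** The strings are numbered: 0-6 are the hubs, 7-36 the gates, 37-66 the spokes and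
    67-76 the centres. *)
Definition offset u := sumn [seq deg v | v <- iota 0 u].
Definition gate u k := (7 + offset u + k %% deg u)%N.
Definition spoke u k := (37 + offset u + k %% deg u)%N.
Definition centre z := (67 + z)%N.
Definition spoke_at u z := spoke u (index z (nth [::] corners u)).

Definition edge_list : seq (nat * nat) :=
  flatten [seq [:: (u, nbr u k); (u, gate u k); (gate u k, gate u k.+1);
      (gate u k, spoke u k); (spoke u k, centre (corner u k))]
    | u <- iota 0 7, k <- iota 0 (deg u)].

(** The symmetrized adjacency lists are evaluated once, since the later computations consult them
    throughout. *)
Definition adj_table : seq (seq nat) := Eval vm_compute in
  [seq [seq j <- iota 0 77 | ((i, j) \in edge_list) || ((j, i) \in edge_list)]
    | i <- iota 0 77].

Definition adj i j := j \in nth [::] adj_table i.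

Definition gates u := [seq gate u k | k <- iota 0 (deg u)].

(** A combinatorial condition that makes the unions of the strings in [L] and in [M] disjoint. *)
Definition apart (L M : seq nat) := all (fun x => all (fun y =>
  [&& (x < 77)%N, (y < 77)%N, x != y & ~~ adj x y]) M) L.

(** [L] absorbs its neighbours in [M] up to [n] times, and must exhaust [M]. *)
Fixpoint grow n (L M : seq nat) :=
  if n is n'.+1 then
    grow n' (L ++ [seq y <- M | has (adj^~ y) L]) [seq y <- M | ~~ has (adj^~ y) L]
  else nilp M.

(** Connectedness of the subgraph induced on [L]; the union of its strings is then connected. *)
Definition linked (L : seq nat) :=
  all (gtn 77) L && (if L is x :: L' then grow (size L') [:: x] L' else true).

(** The part of the frame that leads around [u] from its neighbour number [k] to its
    neighbour number [l]: centres of faces, and the rings of the neighbours passed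
    with the spokes that lead to them. *)
Definition arc u k l :=
  let len := ((l + deg u - k) %% deg u)%N in
  flatten [seq centre (corner u (k + m)) ::
     (if (m.+1 < len)%N then let n := nbr u (k + m).+1 in
        [:: spoke_at n (corner u (k + m)); spoke_at n (corner u (k + m).+1)] ++ gates n
      else [::])
    | m <- iota 0 len].

(** The edges of K_{3,3} from an arc to the rings of [u], [v] and [w]: the whole arc, one spoke and
    the ring. They overlap, but only independent edges have to be disjoint. *)
Definition link_hub u k l := spoke_at u (corner u k) :: arc u k l ++ gates u.
Definition link_first u k l :=
  let v := nbr u k in spoke_at v (corner u k) :: arc u k l ++ gates v.
(** The last face of the arc has number [l - 1] at [u]; [deg u] is added because the predecessor of
    0 is 0. *)
Definition link_last u k l :=
  let w := nbr u l in
  spoke_at w (corner u (l + deg u).-1) :: arc u k l ++ gates w.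

(** [L0], [L1], [L2] are the three edges of the K_{3,3} at an end of [u], at the arc from
    [v] to [w] and at the arc from [w] to [v]. *)
Definition check_K33 u k l :=
  let v := nbr u k in let w := nbr u l in
  let L0 := [:: u :: gates u; v :: gates v; w :: gates w] in
  let L1 := [:: link_hub u k l; link_first u k l; link_last u k l] in
  let L2 := [:: link_hub u l k; link_last u l k; link_first u l k] in
  [&& all linked L0, all linked L1, all linked L2,
   apart [:: u] (spoke_at u (corner u k) :: arc u k l),
   apart [:: u] (spoke_at u (corner u l) :: arc u l k),
   apart [:: u] (nth [::] L1 1) , apart [:: u] (nth [::] L2 1),
   all (fun L => centre (corner u k) \in L) L1, all (fun L => centre (corner u l) \in L) L2,
   all (fun L => all (fun j => gate (nth 0%N [:: u; v; w] j) 0 \in nth [::] L j) (iota 0 3))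
     [:: L0; L1; L2] &
   all (fun i => all (fun j => (i != j) ==>
     [&& apart (nth [::] L0 i) (nth [::] L1 j), apart (nth [::] L0 i) (nth [::] L2 j)
       & apart (nth [::] L1 i) (nth [::] L2 j)]) (iota 0 3)) (iota 0 3)].

Definition hub_edges : seq (nat * nat) :=
  [seq e <- [seq (u, nbr u k) | u <- iota 0 7, k <- iota 0 (deg u)] | (e.1 < e.2)%N].

(** The combinatorial conditions for applying [odd_crossing_tail] to two hubs and their rings. *)
Definition check_edge u v :=
  [&& (u < 7)%N, (v < 7)%N, adj u v,
   has (adj u) (gates u), has (adj v) (gates v), linked (gates u), linked (gates v),
   apart [:: u] (gates v), apart (gates u) [:: v] & apart (gates u) (gates v)].

Definition hub_index u v := index (minn u v, maxn u v) hub_edges.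

(** * The contradiction for strings with odd crossings *)

Section StringGraph.
Variables (R : realType) (r : nat -> seq (plane R)).
Hypothesis size_r : forall i, (i < 77)%N -> (1 < size (r i))%N.
Hypothesis r_disjoint : forall i j, (i < 77)%N -> (j < 77)%N -> i != j -> ~~ adj i j ->
  pl_curve (r i) `&` pl_curve (r j) = set0.
Hypothesis r_meet : forall i j, (i < 77)%N -> (j < 77)%N -> i != j -> adj i j ->
  pl_curve (r i) `&` pl_curve (r j) !=set0.
Hypothesis r_finite : forall i j, (i < 77)%N -> (j < 77)%N -> i != j ->
  finite_set (pl_curve (r i) `&` pl_curve (r j)).

Definition first_end i := head 0 (r i).
Definition tail_pts i := behead (r i).

Lemma curve_trace i : (i < 77)%N -> pl_curve (r i) = trace (first_end i) (tail_pts i).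
Proof.
move=> /size_r; rewrite /first_end /tail_pts.
by case: (r i) => [|a [|b s]] // _; exact: pl_curve_trace.
Qed.

Definition curves (L : seq nat) : set (plane R) :=
  [set p | exists2 i, i \in L & pl_curve (r i) p].

Lemma curves_sub L M : {subset L <= M} -> curves L `<=` curves M.
Proof. by move=> LM p [i /LM iM h]; exists i. Qed.

Lemma apart_disjoint L M : apart L M -> curves L `&` curves M = set0.
Proof.
move=> /allP h; rewrite -subset0 => p [[i iL hi] [j jM hj]].
have /allP/(_ j jM)/and4P[i77 j77 ij nij] := h i iL.
by rewrite -(r_disjoint i77 j77 ij nij).
Qed.

Lemma curve_joined i p q : (i < 77)%N ->
  pl_curve (r i) p -> pl_curve (r i) q -> pl_joined (pl_curve (r i)) p q.
Proof.
move=> /curve_trace ->  hp hq.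
exact: pl_joined_trans (pl_joined_sym (trace_joined hp)) (trace_joined hq).
Qed.

(** Each absorbed string meets a string of [L], and paths are composed at a common point. *)
Lemma grow_joined n L M : (forall i, i \in L ++ M -> (i < 77)%N) ->
  (forall p q, curves L p -> curves L q -> pl_joined (curves L) p q) ->
  grow n L M ->
  forall p q, curves (L ++ M) p -> curves (L ++ M) q -> pl_joined (curves (L ++ M)) p q.
Proof.
elim: n L M => [|n IH] L M lt77 jL /=; first by move=> /nilP ->; rewrite cats0.
set L' := L ++ _; set M' := [seq _ <- M | _] => gr.
have LM : L' ++ M' =i L ++ M.
  by move=> i; rewrite !mem_cat !mem_filter; case: (has _ _); case: (i \in L); case: (i \in M).
have LML p : curves (L ++ M) p <-> curves (L' ++ M') p.
  by split; apply: curves_sub => i; rewrite LM.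
suff jL' p q : curves L' p -> curves L' q -> pl_joined (curves L') p q.
  move=> p q /LML hp /LML hq; 
  have lt' i : i \in L' ++ M' -> (i < 77)%N by rewrite LM; exact: lt77.
  by apply: pl_joined_sub (IH L' M' lt' jL' gr p q hp hq) => z /LML.
have LL' : curves L `<=` curves L' by apply: curves_sub => i; rewrite mem_cat => ->.
have toL z : curves L' z -> exists2 m, curves L m & pl_joined (curves L') z m.
  move=> [y]; rewrite mem_cat => /orP[yL|yM] hz.
    by exists z; [exists y|apply: pl_joined_refl; apply: LL'; exists y].
  move: (yM); rewrite mem_filter => /andP[/hasP[x xL xy] yM'].
  have x77 : (x < 77)%N by apply: lt77; rewrite mem_cat xL.
  have y77 : (y < 77)%N by apply: lt77; rewrite mem_cat yM' orbT.
  have [exy|nxy] := eqVneq x y.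
    rewrite -exy in hz.
    by exists z; [exists x|apply: pl_joined_refl; apply: LL'; exists x].
  have [m [mx my]] := r_meet x77 y77 nxy xy.
  exists m; first by exists x.
  apply: pl_joined_sub (curve_joined y77 hz my) => w hw; exists y => //.
  by rewrite mem_cat yM orbT.
move=> /toL[m hm pm] /toL[m' hm' qm'].
apply: pl_joined_trans pm _; apply: pl_joined_trans (pl_joined_sym qm').
exact: pl_joined_sub LL' (jL _ _ hm hm').
Qed.

Lemma linked_joined L p q : linked L -> curves L p -> curves L q -> pl_joined (curves L) p q.
Proof.
case: L => [|x L]; first by move=> _ [].
move=> /andP[/allP lt77 gr]; apply: (grow_joined (L := [:: x]) lt77 _ gr) => y z.
move=> [i]; rewrite inE => /eqP -> hy [j]; rewrite inE => /eqP -> hz.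
have x77 : (x < 77)%N by apply: lt77; rewrite mem_head.
apply: pl_joined_sub (curve_joined x77 hy hz) => w hw; by exists x; rewrite ?mem_head.
Qed.

Lemma curves_cons i L : curves (i :: L) = pl_curve (r i) `|` curves L.
Proof.
apply/seteqP; split=> p.
  by move=> [j]; rewrite inE => /predU1P[->|jL] h; [left|right; exists j].
by case=> [h|[j jL h]]; [exists i; rewrite ?mem_head|exists j; rewrite // inE jL orbT].
Qed.

Lemma curves1 i : curves [:: i] = pl_curve (r i).
Proof.
by rewrite curves_cons; apply/seteqP; split=> p; [case=> // -[]|left].
Qed.

Lemma finite_curves u L : (u < 77)%N -> (forall i, i \in L -> (i < 77)%N && (i != u)) ->
  finite_set (pl_curve (r u) `&` curves L).
Proof.
move=> u77; elim: L => [|i L IH] h.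
  by rewrite (_ : curves [::] = set0) ?setI0 // -subset0 => p [].
rewrite curves_cons setIUr finite_setU; split.
  have /andP[i77 iu] := h i (mem_head _ _).
  by apply: r_finite => //; rewrite eq_sym.
by apply: IH => j jL; apply: h; rewrite inE jL orbT.
Qed.

Definition end_point u (b : bool) :=
  if b then last (first_end u) (tail_pts u) else first_end u.

(** The end piece number [b] of [u] meets [v]. *)
Definition serves u b v := exists2 q, pl_curve (r v) q &
  pl_joined (pl_curve (r u) `\` curves (gates u)) (end_point u b) q.

Hypothesis r_odd : forall i j, (i < 77)%N -> (j < 77)%N -> i != j -> adj i j ->
  crossing_parity (first_end i) (tail_pts i) (first_end j) (tail_pts j).

(** [odd_crossing_tail] is applied with the two rings as [S] and [T]. *)
Lemma edge_served u v : check_edge u v -> exists b, serves u b v \/ serves v b u.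
Proof.
move=> /and5P[u7 v7 uv /hasP[x xu ux] /and5P[/hasP[y yv vy] lu lv uAv /andP[Auv AuAv]]].
have lt7 w : (w < 7)%N -> (w < 77)%N by move=> h; exact: leq_trans h _.
have gate77 w i : (w < 7)%N -> i \in gates w -> (i < 77)%N && (i != w).
  have /allP h : all (fun w => all (fun i => (i < 77)%N && (i != w)) (gates w)) (iota 0 7).
    by vm_compute.
  move=> w7 iw; have w07 : w \in iota 0 7 by rewrite mem_iota.
  exact: (allP (h w w07)).
have u77 := lt7 u u7; have v77 := lt7 v v7.
have nuv : u != v.
  apply/eqP => e; move: uAv; rewrite -e.
  by move=> /allP/(_ _ (mem_head _ _))/allP/(_ x xu)/and4P[_ _ _]; rewrite ux.
have meets w z : (w < 7)%N -> z \in gates w -> adj w z ->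
    pl_curve (r w) `&` curves (gates w) !=set0.
  move=> w7 zw wz; have /andP[z77 zw'] := gate77 w z w7 zw.
  have wnz : w != z by rewrite eq_sym.
  have [p [p1 p2]] := r_meet (lt7 w w7) z77 wnz wz.
  by exists p; split=> //; exists z.
have := @odd_crossing_tail R (first_end u) (tail_pts u) (first_end v) (tail_pts v)
  (curves (gates u)) (curves (gates v)).
rewrite -!curve_trace // /tail_meets -!curve_trace //.
case=> //.
- by apply: finite_curves => // i; exact: gate77.
- exact: meets xu ux.
- by apply: finite_curves => // i; exact: gate77.
- exact: meets yv vy.
- by move=> p q; exact: linked_joined.
- by move=> p q; exact: linked_joined.
- by rewrite -curves1; exact: apart_disjoint.
- by rewrite -(curves1 v); exact: apart_disjoint.
- exact: apart_disjoint.
- exact: r_odd.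
- by move=> [q hq [h|h]]; [exists false|exists true]; left; exists q.
- by move=> [q hq [h|h]]; [exists false|exists true]; right; exists q.
Qed.

(** One side of the K_{3,3} consists of [q], where the end piece meets [v], and of a point on the
    first centre of each arc. The other side has a point on the ring of each of [u], [v] and [w]. *)
Lemma serves_uniq u k l b : (u < 77)%N -> check_K33 u k l ->
  serves u b (nbr u k) -> serves u b (nbr u l) -> False.
Proof.
rewrite /check_K33; set v := nbr u k; set w := nbr u l; set L0 := [:: _; _; _].
set L1 := [:: link_hub u k l; _; _]; set L2 := [:: link_hub u l k; _; _].
move=> u77 /and5P[lk0 lk1 lk2 ua1 /and5P[ua2 ub1 ub2 c1 /and3P[c2 rg ap]]].
move=> [q hq jq] [q' hq' jq'].
have lt77 L i : linked L -> i \in L -> (i < 77)%N.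
  by move=> /andP[/allP h _] iL; exact: h i iL.
have I3 (j : 'I_3) : (j : nat) \in iota 0 3 by rewrite mem_iota /= add0n ltn_ord.
have nthI (L : seq (seq nat)) (P : pred (seq nat)) (j : 'I_3) :
    size L = 3 -> all P L -> P (nth [::] L j).
  by move=> sL /allP; apply; rewrite mem_nth // sL.
have rgP L (j : 'I_3) : L \in [:: L0; L1; L2] ->
    gate (nth 0%N [:: u; v; w] j) 0 \in nth [::] L j.
  by move=> /(allP rg)/allP/(_ _ (I3 j)).
have apP (i j : 'I_3) : i != j -> [&& apart (nth [::] L0 i) (nth [::] L1 j),
    apart (nth [::] L0 i) (nth [::] L2 j) & apart (nth [::] L1 i) (nth [::] L2 j)].
  move=> ij; have /allP/(_ _ (I3 j)) := allP ap _ (I3 i).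
  by rewrite -val_eqE in ij; rewrite ij.
have endin i : (i < 77)%N -> pl_curve (r i) (first_end i).
  by move=> /curve_trace ->; exact: trace_head.
(* The edge from [q] to the ring of [w] runs through the end piece to [q'] on [w]. The gates of [u]
   are removed because they belong to the edges from the arcs to the ring of [u]. *)
pose S2 := (pl_curve (r u) `\` curves (gates u)) `|` curves (w :: gates w).
pose S (i j : 'I_3) : set (plane R) := match val i, val j with
  | 0, 2 => S2 | 0, _ => curves (nth [::] L0 j)
  | 1, _ => curves (nth [::] L1 j) | _, _ => curves (nth [::] L2 j) end.
pose P (i : 'I_3) := match val i with 0 => q | 1 => first_end (centre (corner u k))
  | _ => first_end (centre (corner u l)) end.
pose Q (j : 'I_3) := first_end (gate (nth 0%N [:: u; v; w] j) 0).
apply: (@no_K33 R P Q S).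
  have Qin L (j : 'I_3) : L \in [:: L0; L1; L2] -> linked (nth [::] L j) ->
      curves (nth [::] L j) (Q j).
    move=> hL lk; have h := rgP L j hL; exists (gate (nth 0%N [:: u; v; w] j) 0) => //.
    by apply: endin; exact: lt77 lk h.
  have lk0P (j : 'I_3) := nthI L0 linked j erefl lk0.
  have lk1P (j : 'I_3) := nthI L1 linked j erefl lk1.
  have lk2P (j : 'I_3) := nthI L2 linked j erefl lk2.
  have Pu : pl_curve (r u) q by have [_ []] := pl_joined_mem jq.
  move=> i j; case: i => [[|[|[|//]]] ilt]; rewrite /S /P /=.
  - case: j => [[|[|[|//]]] jlt] /=.
    + apply: linked_joined; [exact: (lk0P (Ordinal jlt))| |].
        by exists u; rewrite ?mem_head.
      by apply: (Qin L0 (Ordinal jlt)); [rewrite mem_head|exact: (lk0P (Ordinal jlt))].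
    + apply: linked_joined; [exact: (lk0P (Ordinal jlt))| |].
        by exists v; rewrite ?mem_head.
      by apply: (Qin L0 (Ordinal jlt)); [rewrite mem_head|exact: (lk0P (Ordinal jlt))].
    + apply: (@pl_joined_trans _ _ _ q').
        apply: pl_joined_sub (pl_joined_trans (pl_joined_sym jq) jq') => z; by left.
      apply: (@pl_joined_sub _ (curves (w :: gates w))); first by move=> z; right.
      apply: linked_joined; [exact: (lk0P (Ordinal jlt))| |].
        by exists w; rewrite ?mem_head.
      by apply: (Qin L0 (Ordinal jlt)); [rewrite mem_head|exact: (lk0P (Ordinal jlt))].
  - apply: linked_joined; [exact: lk1P| |].
      exists (centre (corner u k)); first exact: (nthI L1 (fun L => _ \in L) j erefl c1).
      by apply: endin; apply: (lt77 _ _ (lk1P j));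
        exact: (nthI L1 (fun L => _ \in L) j erefl c1).
    by apply: Qin; rewrite ?inE ?eqxx ?orbT //; exact: lk1P.
  - apply: linked_joined; [exact: lk2P| |].
      exists (centre (corner u l)); first exact: (nthI L2 (fun L => _ \in L) j erefl c2).
      by apply: endin; apply: (lt77 _ _ (lk2P j));
        exact: (nthI L2 (fun L => _ \in L) j erefl c2).
    by apply: Qin; rewrite ?inE ?eqxx ?orbT //; exact: lk2P.
have dis0 (i : 'I_3) j j' : i != 0 -> j != j' -> S 0 j `&` S i j' = set0.
  move=> i0 jj; have /and3P[ap1 ap2 _] := apP j j' jj.
  have Lj : curves (nth [::] L0 j) `&` S i j' = set0.
    case: i i0 => [[|[|[|//]]] ilt] // _; exact: apart_disjoint.
  have [S0j|->//] : S 0 j = S2 /\ j = 2%:R \/ S 0 j = curves (nth [::] L0 j).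
    by case: j {jj ap1 ap2 Lj} => [[|[|[|//]]] jlt];
      [right|right|left; split=> //; exact: val_inj].
  case: S0j => S0j j2; rewrite S0j setIUl setU_eq0; split; last by rewrite j2 in Lj.
  have avoid M : apart [:: u] M -> pl_curve (r u) `&` curves M = set0.
    by rewrite -curves1; exact: apart_disjoint.
  have hub0 M : apart [:: u] M ->
      (pl_curve (r u) `\` curves (gates u)) `&` curves (M ++ gates u) = set0.
    move=> /avoid h; rewrite -subset0 => z [[z1 z2] [x]]; rewrite mem_cat => /orP[xM|xr] hx.
      by rewrite -h; split=> //; exists x.
    by apply: z2; exists x.
  rewrite j2 in jj; case: j' jj {Lj ap1 ap2} => [[|[|[|//]]] jlt] // _.
    by case: i i0 => [[|[|[|//]]] ilt] // _;
      [exact: (hub0 (_ :: arc u k l))|exact: (hub0 (_ :: arc u l k))].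
  rewrite -subset0 => z [[z1 _] z2]; case: i i0 z2 => [[|[|[|//]]] ilt] // _ z2.
    by rewrite -(avoid _ ub1).
  by rewrite -(avoid _ ub2).
have dis12 j j' : j != j' -> S 1 j `&` S 2%:R j' = set0.
  by move=> jj; have /and3P[_ _ /apart_disjoint] := apP j j' jj.
move=> i i' j j' ii jj.
have [i0|i0] := eqVneq i 0; first by rewrite i0; apply: dis0 => //; rewrite -i0 eq_sym.
have [i0'|i0'] := eqVneq i' 0.
  by rewrite i0' setIC; apply: dis0 => //; rewrite eq_sym.
have i12 (x : 'I_3) : x != 0 -> x = 1 \/ x = 2%:R.
  by case: x => [[|[|[|//]]] xlt] // _; [left|right]; exact: val_inj.
have [e|e] := i12 i i0; have [e'|e'] := i12 i' i0'; rewrite e e' ?eqxx // in ii *.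
  exact: dis12.
by rewrite setIC; apply: dis12; rewrite eq_sym.
Qed.

(** Pigeonhole: 15 edges are assigned to the 14 pairs of a hub and an end. Two edges with the same
    pair have different neighbour numbers, because the hub and this number determine the edge
    through [hub_index]. *)
Lemma odd_strings_absurd : False.
Proof.
have edge (i : 'I_15) : exists x : 'I_7 * bool * nat,
    [/\ (x.2 < deg x.1.1)%N, hub_index x.1.1 (nbr x.1.1 x.2) = i &
      serves x.1.1 x.1.2 (nbr x.1.1 x.2)].
  have : all (fun i : nat => let: (u, v) := nth (0, 0)%N hub_edges i in
      let k := index v (nth [::] nbrs u) in let l := index u (nth [::] nbrs v) in
      [&& check_edge u v, (k < deg u)%N, (l < deg v)%N, nbr u k == v & 
          [&& nbr v l == u, hub_index u v == i & hub_index v u == i]]) (iota 0 15).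
    by vm_compute.
  move=> /allP/(_ i); rewrite mem_iota /= add0n ltn_ord => /(_ isT).
  case: (nth _ _ _) => [u v] /and5P[ce ku lv /eqP ek /and3P[/eqP el /eqP iu /eqP iv]].
  have /and3P[u7 v7 _] := ce.
  have [b [h|h]] := edge_served ce.
    by exists (Ordinal u7, b, index v (nth [::] nbrs u)); rewrite /= ek.
  by exists (Ordinal v7, b, index u (nth [::] nbrs v)); rewrite /= el.
have [f hf] := choice edge.
have : ~~ injectiveb (fun i => (f i).1).
  apply/negP => /injectiveP /leq_card; rewrite card_prod !card_ord card_bool.
  by [].
case/injectivePn => i [j ij eij].
have [ki ei si] := hf i; have [kj ej sj] := hf j.
rewrite -eij in kj ej sj; move: ij ki ei si kj ej sj.
case: (f i) => [[u b] k] /=; case: (f j) => [_ l] /= ij ki ei si kj ej sj.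
have kl : k != l by apply: contra_neq ij => kl; apply: val_inj; rewrite /= -ei -ej kl.
have : all (fun u => all (fun k => all (fun l => (k != l) ==> check_K33 u k l)
    (iota 0 (deg u))) (iota 0 (deg u))) (iota 0 7) by vm_compute.
move=> /allP/(_ u); rewrite mem_iota /= add0n ltn_ord => /(_ isT).
move=> /allP/(_ k); rewrite mem_iota /= add0n ki => /(_ isT).
move=> /allP/(_ l); rewrite mem_iota /= add0n kj kl => /(_ isT) ck.
by apply: (serves_uniq _ ck si sj); exact: leq_trans (ltn_ord u) _.
Qed.

End StringGraph.

(** * A representation with integer coordinates *)

(** The coordinates are binary integers, so that the geometric checks can be run by [vm_compute]. *)
Definition hub_coords : seq (seq (Z * Z)) := [::
   [:: (-7248, 83); (-7290, -33); (-7183, -95); (150, 0); (-7105, 14); (-3456,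
      1092); (-7116, 46); (-4837, 2048); (-7141, 76); (-3533, 7334); (-7176,
      93)];
   [:: (7176, 93); (3533, 7334); (7141, 76); (4837, 2048); (7116, 46); (3456,
      1092); (7105, 14); (-150, 0); (7183, -95); (7290, -33); (7248, 83)];
   [:: (2771, 3965); (1313, 9295); (2652, 3983); (1244, 5356); (2604, 3909);
      (1225, 2917); (2694, 3804); (5063, 1852); (2790, 3934)];
   [:: (81, 6652); (0, 10650); (-89, 6637); (-1456, 5144); (-37, 6511); (0,
      4200); (37, 6511); (1456, 5144); (94, 6621)];
   [:: (-2606, 3919); (-1244, 5356); (-2652, 3983); (-1313, 9295); (-2782,
      3951); (-5063, 1852); (-2694, 3804); (-1225, 2917); (-2604, 3900)];
   [:: (94, 2121); (1475, 3083); (45, 2185); (0, 4500); (-45, 2185); (-1475,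
      3083); (-95, 2115); (-3744, 1008); (0, 2004); (3744, 1008); (96, 2108)];
   [:: (-38, 14488); (-96, 14403); (-3667, 7066); (-34, 14310); (-1387, 9005);
      (-12, 14305); (0, 10350); (12, 14305); (1387, 9005); (34, 14310); (3667,
      7066); (96, 14403); (38, 14488)]]%binZ.

Definition gate_coords0 : seq (seq (Z * Z)) := [::
   [:: (-7081, 613); (-7063, 560); (-7102, 519); (-7534, 344); (-7672, -88);
      (-7387, -442); (-6935, -400); (-6720, 0); (-6725, 68); (-6440, 110)];
   [:: (-6584, 103); (-6628, 67); (-6679, 89); (-6739, 134); (-6779, 230);
      (-6526, 369)];
   [:: (-6659, 311); (-6687, 263); (-6743, 265); (-6837, 314); (-6906, 379);
      (-6730, 608)];
   [:: (-6829, 502); (-6835, 446); (-6888, 426); (-6985, 429); (-7098, 469);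
      (-7038, 751)]]%binZ.

Definition gate_coords1 : seq (seq (Z * Z)) := [::
   [:: (7053, 607); (7091, 566); (7073, 513); (6985, 429); (6906, 379); (6728,
      606)];
   [:: (6806, 484); (6858, 464); (6865, 408); (6837, 314); (6779, 230); (6525,
      366)];
   [:: (6645, 286); (6701, 288); (6729, 240); (6739, 134); (6725, 68); (6440,
      107)];
   [:: (6580, 74); (6632, 96); (6675, 60); (6720, 0); (6935, -400); (7387,
      -442); (7672, -88); (7534, 344); (7098, 469); (7035, 750)]]%binZ.

Definition gate_coords2 : seq (seq (Z * Z)) := [::
   [:: (3223, 4241); (3197, 4191); (3141, 4190); (2879, 4345); (2580, 4365);
      (2462, 4317); (2318, 4566)];
   [:: (2378, 4435); (2427, 4407); (2426, 4351); (2361, 4239); (2222, 3947);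
      (1936, 3974)];
   [:: (2078, 3947); (2128, 3971); (2173, 3938); (2301, 3634); (2670, 3421);
      (2653, 3133)];
   [:: (2675, 3276); (2649, 3326); (2681, 3372); (3063, 3586); (3178, 3862);
      (3108, 4153); (3352, 4305)]]%binZ.

Definition gate_coords3 : seq (seq (Z * Z)) := [::
   [:: (571, 6852); (538, 6807); (482, 6815); (267, 6999); (0, 7080); (-267,
      6999); (-443, 6784); (-710, 6893)];
   [:: (-582, 6825); (-527, 6834); (-493, 6789); (-471, 6506); (-339, 6261);
      (-184, 6157); (-293, 5890)];
   [:: (-225, 6018); (-234, 6073); (-189, 6107); (0, 6120); (184, 6157); (295,
      5891)];
   [:: (252, 6029); (207, 6062); (215, 6118); (339, 6261); (471, 6506); (443,
      6784); (709, 6895)]]%binZ.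

Definition gate_coords4 : seq (seq (Z * Z)) := [::
   [:: (-2080, 3976); (-2125, 3942); (-2176, 3966); (-2361, 4239); (-2462,
      4317); (-2321, 4568)];
   [:: (-2403, 4449); (-2402, 4393); (-2451, 4366); (-2580, 4365); (-2879,
      4345); (-3108, 4153); (-3354, 4303)];
   [:: (-3238, 4216); (-3182, 4215); (-3157, 4166); (-3178, 3862); (-3063,
      3586); (-2670, 3421); (-2650, 3134)];
   [:: (-2646, 3278); (-2678, 3324); (-2652, 3374); (-2301, 3634); (-2222,
      3947); (-1936, 3977)]]%binZ.

Definition gate_coords5 : seq (seq (Z * Z)) := [::
   [:: (615, 2209); (572, 2173); (520, 2194); (399, 2366); (226, 2523); (361,
      2778)];
   [:: (282, 2657); (284, 2601); (236, 2572); (0, 2580); (-226, 2523); (-364,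
      2776)];
   [:: (-307, 2643); (-259, 2615); (-262, 2559); (-399, 2366); (-474, 2173);
      (-759, 2215)];
   [:: (-619, 2180); (-567, 2202); (-524, 2166); (-461, 1966); (-288, 1716);
      (0, 1620); (1, 1332)];
   [:: (14, 1476); (-14, 1524); (14, 1572); (288, 1716); (461, 1966); (474,
      2173); (759, 2218)]]%binZ.

Definition gate_coords6 : seq (seq (Z * Z)) := [::
   [:: (-14, 15024); (14, 14976); (-14, 14928); (-374, 14701); (-469, 14298);
      (-215, 13971); (-168, 13950); (-268, 13680)];
   [:: (-205, 13810); (-215, 13865); (-171, 13900); (-120, 13935); (-60,
      13924); (-95, 13638)];
   [:: (-64, 13779); (-87, 13830); (-52, 13874); (0, 13920); (60, 13924); (98,
      13638)];
   [:: (93, 13783); (58, 13827); (81, 13878); (120, 13935); (168, 13950);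
      (270, 13681)];
   [:: (232, 13821); (188, 13855); (198, 13910); (215, 13971); (469, 14298);
      (374, 14701); (0, 14880); (-1, 15168)]]%binZ.

Definition spoke_coords0 : seq (seq (Z * Z)) := [::
   [:: (-6537, 109); (-6499, 86); (-6470, 119); (-11, 959); (-110, 964)];
   [:: (-6617, 334); (-6574, 325); (-6558, 366); (-2559, 2529); (-2684, 2494)];
   [:: (-6799, 540); (-6756, 549); (-6758, 593); (-3761, 4546); (-3805, 4456)];
   [:: (-7071, 660); (-7036, 686); (-7056, 725); (-92, 33059); (-88, 32941)]]%binZ.

Definition spoke_coords1 : seq (seq (Z * Z)) := [::
   [:: (6777, 522); (6779, 566); (6735, 575); (3761, 4546); (3805, 4456)];
   [:: (6603, 309); (6587, 350); (6544, 341); (2559, 2529); (2684, 2494)];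
   [:: (6533, 81); (6504, 114); (6466, 90); (-59, 1037); (79, 1042)];
   [:: (7043, 653); (7064, 692); (7028, 719); (92, 33059); (148, 32941)]]%binZ.

Definition spoke_coords2 : seq (seq (Z * Z)) := [::
   [:: (2354, 4477); (2363, 4520); (2321, 4535); (1008, 7008); (1039, 6913)];
   [:: (2030, 3952); (1999, 3984); (1963, 3959); (1085, 4117); (1231, 4119)];
   [:: (2672, 3228); (2641, 3197); (2668, 3161); (2678, 2518); (2706, 2661)];
   [:: (3264, 4266); (3308, 4259); (3321, 4301); (3642, 4563); (3510, 4505)]]%binZ.

Definition spoke_coords3 : seq (seq (Z * Z)) := [::
   [:: (-626, 6844); (-646, 6883); (-688, 6870); (-893, 7044); (-754, 7007)];
   [:: (-244, 5974); (-283, 5954); (-270, 5912); (-1074, 4008); (-1055, 4132)];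
   [:: (270, 5985); (257, 5943); (296, 5923); (1074, 4008); (1055, 4132)];
   [:: (615, 6870); (657, 6857); (677, 6896); (893, 7044); (754, 7007)]]%binZ.

Definition spoke_coords4 : seq (seq (Z * Z)) := [::
   [:: (-2379, 4491); (-2338, 4506); (-2346, 4549); (-1008, 7008); (-1039,
      6913)];
   [:: (-3279, 4241); (-3292, 4284); (-3336, 4277); (-3642, 4563); (-3510,
      4505)];
   [:: (-2643, 3230); (-2670, 3195); (-2639, 3163); (-2678, 2518); (-2706,
      2661)];
   [:: (-2033, 3981); (-1996, 3955); (-1966, 3987); (-1085, 4117); (-1231,
      4119)]]%binZ.

Definition spoke_coords5 : seq (seq (Z * Z)) := [::
   [:: (304, 2699); (346, 2715); (336, 2759); (985, 4069); (956, 3976)];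
   [:: (-330, 2686); (-320, 2729); (-361, 2745); (-985, 4069); (-956, 3976)];
   [:: (-666, 2188); (-695, 2221); (-733, 2198); (-2601, 2431); (-2502, 2436)];
   [:: (14, 1428); (-14, 1394); (14, 1361); (70, 1047); (90, 1189)];
   [:: (662, 2216); (700, 2193); (728, 2226); (2601, 2431); (2502, 2436)]]%binZ.

Definition spoke_coords6 : seq (seq (Z * Z)) := [::
   [:: (-222, 13765); (-261, 13744); (-245, 13703); (-3715, 4459); (-3644,
      4576)];
   [:: (-70, 13732); (-103, 13702); (-78, 13665); (-945, 6929); (-902, 7057)];
   [:: (99, 13735); (74, 13698); (107, 13668); (945, 6929); (902, 7057)];
   [:: (249, 13776); (234, 13734); (272, 13713); (3715, 4459); (3644, 4576)];
   [:: (-14, 15072); (14, 15106); (-14, 15139); (0, 33060); (30, 32940)]]%binZ.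

Definition centre_coords : seq (seq (Z * Z)) := [::
   [:: (-141, 873); (141, 1185)];
   [:: (-2471, 2344); (-2752, 2656)];
   [:: (-3902, 4483); (-3487, 4548)];
   [:: (-210, 33000); (210, 33000)];
   [:: (3902, 4483); (3487, 4548)];
   [:: (2471, 2344); (2752, 2656)];
   [:: (1137, 6924); (738, 7053)];
   [:: (864, 3968); (1238, 4159)];
   [:: (-1137, 6924); (-738, 7053)];
   [:: (-864, 3968); (-1238, 4159)]]%binZ.

(** The order agrees with the numbering of the strings: hubs, gates, spokes, centres. *)
Definition string_coords :=
  hub_coords ++ gate_coords0 ++ gate_coords1 ++ gate_coords2 ++ gate_coords3 ++
  gate_coords4 ++ gate_coords5 ++ gate_coords6 ++
  spoke_coords0 ++ spoke_coords1 ++ spoke_coords2 ++ spoke_coords3 ++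
  spoke_coords4 ++ spoke_coords5 ++ spoke_coords6 ++ centre_coords.

Definition orientZ (a b c : Z * Z) : Z :=
  ((b.1 - a.1) * (c.2 - a.2) - (b.2 - a.2) * (c.1 - a.1))%binZ.

(** Multiplying signs is cheaper than multiplying the numbers. *)
Definition opposite_signs (x y : Z) := (Z.sgn x * Z.sgn y <? 0)%binZ.

Definition same_sign (x y : Z) := (0 <? Z.sgn x * Z.sgn y)%binZ.

Definition crossingZ (a b c d : Z * Z) :=
  opposite_signs (orientZ a b c) (orientZ a b d) &&
  opposite_signs (orientZ c d a) (orientZ c d b).

Definition separatedZ (a b c d : Z * Z) :=
  same_sign (orientZ a b c) (orientZ a b d) ||
  same_sign (orientZ c d a) (orientZ c d b).

Definition below4 (x y z t : Z) :=
  [&& x <? z, x <? t, y <? z & y <? t]%binZ.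

(** Disjointness of the bounding boxes, a cheap test that disposes of distant segments before any
    orientation is computed. *)
Definition boxes_apart (a b c d : Z * Z) :=
  [|| below4 a.1 b.1 c.1 d.1, below4 c.1 d.1 a.1 b.1,
      below4 a.2 b.2 c.2 d.2 | below4 c.2 d.2 a.2 b.2].

Definition ptZ (s : seq (Z * Z)) i := nth (0, 0)%binZ s i.

Definition on_segments (P : Z * Z -> Z * Z -> Z * Z -> Z * Z -> bool) s t i j :=
  P (ptZ s i) (ptZ s i.+1) (ptZ t j) (ptZ t j.+1).

Definition segment_pairs (s t : seq (Z * Z)) :=
  [seq (i, j) | i <- iota 0 (size s).-1, j <- iota 0 (size t).-1].

Definition near_pairs s t :=
  [seq ij <- segment_pairs s t | ~~ on_segments boxes_apart s t ij.1 ij.2].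

Definition crossing_pairsZ s t :=
  [seq ij <- near_pairs s t | on_segments crossingZ s t ij.1 ij.2].

(** Consecutive segments that are not collinear meet only at their common vertex and make a genuine
    bend there; segments further apart have to be separated. *)
Definition check_simple s :=
  (1 < size s)%N &&
  all (fun ij : nat * nat => let: (i, j) := ij in
    if i == j then ~~ (Z.eqb (ptZ s i).1 (ptZ s i.+1).1 && Z.eqb (ptZ s i).2 (ptZ s i.+1).2)
    else if j == i.+1 then ~~ Z.eqb (orientZ (ptZ s i) (ptZ s j) (ptZ s j.+1)) 0
    else (j < i)%N || on_segments separatedZ s s i j) (segment_pairs s s).

Definition coords u := nth [::] string_coords u.

(** Each near pair of segments must either cross or be separated, which excludes touching. *)
Definition check_pair u v :=
  let s := coords u in let t := coords v in
  let P := near_pairs s t in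
  let X := [seq ij <- P | on_segments crossingZ s t ij.1 ij.2] in
  (size X == if adj u v then 2 else 0) &&
  all (fun ij => on_segments separatedZ s t ij.1 ij.2)
    [seq ij <- P | ~~ on_segments crossingZ s t ij.1 ij.2].

(** Segments of three strings through one point would cross pairwise. Excluding this avoids
    computing intersection points. *)
Definition check_triple u v w :=
  all (fun ij : nat * nat => all (fun ik : nat * nat =>
      (ij.1 == ik.1) ==> ~~ on_segments crossingZ (coords v) (coords w) ij.2 ik.2)
    (crossing_pairsZ (coords u) (coords w))) (crossing_pairsZ (coords u) (coords v)).

Lemma strings_simple : all check_simple string_coords.
Proof. by vm_compute. Qed.

Lemma string_pairs : all (fun u => all (fun v => (u < v)%N ==> check_pair u v)
  (iota 0 77)) (iota 0 77).
Proof. by vm_compute. Qed.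

(** Testing neighbours of [u] suffices, since the other strings do not meet [u]. *)
Lemma string_triples : all (fun u => all (fun v => all (fun w =>
    (v != w) ==> check_triple u v w) (nth [::] adj_table u))
  (nth [::] adj_table u)) (iota 0 77).
Proof. by vm_compute. Qed.

(** * Transfer of the integer checks to the reals *)

Section Realization.
Variable R : realType.
Implicit Types s t : seq (Z * Z).

Definition ZtoR (z : Z) : R := (int_of_Z z)%:~R.

Lemma ZtoRB x y : ZtoR (x - y) = ZtoR x - ZtoR y.
Proof. by rewrite -intrB; congr (_%:~R); apply: (can_inj Z_of_intK); lia. Qed.

Lemma ZtoRM x y : ZtoR (x * y) = ZtoR x * ZtoR y.
Proof. by rewrite -intrM; congr (_%:~R); apply: (can_inj Z_of_intK); lia. Qed.

Lemma ZtoR_lt x y : (ZtoR x < ZtoR y) = Z.ltb x y.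
Proof. by rewrite ltr_int; apply/idP/idP; lia. Qed.

Lemma ZtoR_eq x y : (ZtoR x == ZtoR y) = Z.eqb x y.
Proof. by rewrite eqr_int; apply/idP/idP; lia. Qed.

Definition toR (p : Z * Z) : plane R := (ZtoR p.1, ZtoR p.2).

Lemma orient_toR a b c : orient (toR a) (toR b) (toR c) = ZtoR (orientZ a b c).
Proof. by rewrite /orientZ !(ZtoRB, ZtoRM). Qed.

Lemma ZtoR_lt0 x y : (ZtoR x * ZtoR y < 0) = opposite_signs x y.
Proof.
rewrite -ZtoRM -[0]/(ZtoR 0) ZtoR_lt /opposite_signs -Z.sgn_mul.
by case: (x * y)%binZ.
Qed.

Lemma ZtoR_gt0 x y : (0 < ZtoR x * ZtoR y) = same_sign x y.
Proof.
rewrite -ZtoRM -[0]/(ZtoR 0) ZtoR_lt /same_sign -Z.sgn_mul.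
by case: (x * y)%binZ.
Qed.

Lemma crossing_toR a b c d :
  crossing (toR a) (toR b) (toR c) (toR d) = crossingZ a b c d.
Proof. by rewrite /crossing !orient_toR !ZtoR_lt0. Qed.

Lemma separated_toR a b c d :
  separated (toR a) (toR b) (toR c) (toR d) = separatedZ a b c d.
Proof. by rewrite /separated !orient_toR !ZtoR_gt0. Qed.

Lemma below4_conv (a b c d : Z) (t u : R) : below4 a b c d -> 0 <= t <= 1 -> 0 <= u <= 1 ->
  (1 - t) * ZtoR a + t * ZtoR b < (1 - u) * ZtoR c + u * ZtoR d.
Proof.
rewrite /below4 -!ZtoR_lt => /and4P[ac ad bc bd] ht hu.
move: (ZtoR a) (ZtoR b) (ZtoR c) (ZtoR d) ac ad bc bd => {}a {}b {}c {}d ac ad bc bd.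
have [ab|ba] := leP a b; have [cd|dc] := leP c d.
- have : (1 - t) * a + t * b <= b by nra.
  have : c <= (1 - u) * c + u * d by nra.
  lra.
- have : (1 - t) * a + t * b <= b by nra.
  have : d <= (1 - u) * c + u * d by nra.
  lra.
- have : (1 - t) * a + t * b <= a by nra.
  have : c <= (1 - u) * c + u * d by nra.
  lra.
- have : (1 - t) * a + t * b <= a by nra.
  have : d <= (1 - u) * c + u * d by nra.
  lra.
Qed.

Lemma boxes_apart_disjoint a b c d p : boxes_apart a b c d ->
  seg (toR a) (toR b) p -> seg (toR c) (toR d) p -> False.
Proof.
move=> h /segP[t [ht e1 e2]] /segP[u [hu e1' e2']].
move: e1 e1' e2 e2' => /= -> e1 -> e2.
by case/or4P: h => /below4_conv h; [have := h t u ht hu|have := h u t hu ht|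
  have := h t u ht hu|have := h u t hu ht]; lra.
Qed.

Definition string u := map toR (coords u).

Lemma nth_toR s i : nth 0 (map toR s) i = toR (ptZ s i).
Proof.
have [h|h] := ltnP i (size s); first by rewrite (nth_map (0, 0)%binZ).
by rewrite !nth_default ?size_map // /ptZ nth_default.
Qed.

Lemma crossing_at_toR s t i j :
  crossing_at (map toR s) (map toR t) i j = on_segments crossingZ s t i j.
Proof. by rewrite /crossing_at !nth_toR crossing_toR. Qed.

(** Discarding segments with disjoint boxes loses no crossing, as crossing segments have a common
    point. *)
Lemma crossing_pairs_toR s t :
  crossing_pairs (map toR s) (map toR t) = crossing_pairsZ s t.
Proof.
rewrite /crossing_pairsZ /crossing_pairs !size_map -filter_predI.
apply: eq_filter => -[i j] /=; rewrite crossing_at_toR.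
apply/idP/andP => [h|[]//]; split=> //; apply/negP => hb.
move: h; rewrite /on_segments -crossing_toR => /crossing_meet[p].
exact: boxes_apart_disjoint.
Qed.

Lemma segment_pairsP s t i j : (i.+1 < size (map toR s))%N -> (j.+1 < size (map toR t))%N ->
  (i, j) \in segment_pairs s t.
Proof.
rewrite !size_map => hi hj; apply: allpairs_f; rewrite mem_iota /= add0n.
  by case: (size s) hi.
by case: (size t) hj.
Qed.

Lemma check_simpleP s : check_simple s -> simple_pl_curve (map toR s).
Proof.
move=> /andP[s1 /allP h]; have {}h i j hi hj := h (i, j) (segment_pairsP hi hj).
have neq i : (i.+1 < size (map toR s))%N -> toR (ptZ s i) != toR (ptZ s i.+1).
  by move=> hi; have := h i i hi hi; rewrite /= eqxx xpair_eqE !ZtoR_eq.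
have bend i : (i.+2 < size (map toR s))%N ->
    orient (toR (ptZ s i)) (toR (ptZ s i.+1)) (toR (ptZ s i.+2)) != 0.
  move=> hi; have := h i i.+1 (ltnW hi) hi.
  by rewrite /= eqxx eqn_leq ltnn andbF orient_toR -[0]/(ZtoR 0) ZtoR_eq.
split; first by rewrite size_map.
- move=> i j t u; wlog ij : i j t u / (i <= j)%N.
    move=> H hi hj ht hu e; have [|/ltnW] := leqP i j => ij; first exact: H e.
    by apply/esym; apply: (H j i u t).
  move=> hi hj ht hu; rewrite /pl_point !nth_toR => e.
  have [eij|nij] := eqVneq i j.
    by rewrite -eij in e *; rewrite (comb_inj (neq i hi) e).
  have {nij} {}ij : (i < j)%N by rewrite ltn_neqAle nij.
  have [ej|nj] := eqVneq j i.+1; last first.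
    have := h i j hi hj; rewrite /= (ltn_eqF ij) (negbTE nj) ltnNge (ltnW ij) /=.
    rewrite /on_segments -separated_toR => /separatedP hs; exfalso.
    by apply: (hs (pl_point (map toR s) i t)); rewrite /pl_point !nth_toR; [exists t|exists u].
  move: hj e; rewrite ej => hj e; have b := bend i hj.
  (* The orientation with respect to the first segment vanishes at the shared vertex but not at the
     end of the second segment. So a common point has [u = 0], and then [t = 1]. *)
  have h0 : orient (toR (ptZ s i)) (toR (ptZ s i.+1))
      ((1 - u) *: toR (ptZ s i.+1) + u *: toR (ptZ s i.+2)) = 0.
    by rewrite -e; apply: orient_seg0; exists t.
  move: h0; rewrite orient_comb (orient_seg0 (seg_right _ _)) mulr0 add0r => /eqP.
  rewrite mulf_eq0 (negbTE b) orbF => /eqP u0.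
  move: e; rewrite u0 subr0 scale1r scale0r !addr0 => e.
  suff -> : t = 1 by rewrite -natr1.
  apply: (comb_inj (neq i hi)); rewrite e subrr scale0r scale1r add0r //.
- move=> i hi; have := bend i hi; rewrite /collinear !nth_toR => /eqP b e; apply: b.
  by rewrite /orient e subrr.
Qed.

End Realization.

Lemma all_iota_ord n (P : pred nat) : all P (iota 0 n) -> forall i : 'I_n, P i.
Proof. by move=> /allP h i; apply: h; rewrite mem_iota /= add0n ltn_ord. Qed.

Lemma mem_vertex (R : realType) (s : seq (plane R)) x : (1 < size s)%N -> x \in s ->
  exists2 k, (k.+1 < size s)%N & (x == nth 0 s k) || (x == nth 0 s k.+1).
Proof.
move=> s1 xs; have h : (index x s < size s)%N by rewrite index_mem.
have [h1|h1] := ltnP (index x s).+1 (size s).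
  by exists (index x s); rewrite ?nth_index ?eqxx.
have [k ek] : exists k, index x s = k.+1.
  by exists (index x s).-1; rewrite prednK // -ltnS; exact: leq_trans s1 h1.
by exists k; rewrite -ek // nth_index // eqxx orbT.
Qed.

(** * Properties of the 77 strings *)

Section Strings.
Variable R : realType.
Local Notation string := (string R).
Local Notation C u := (pl_curve (string u)).

Lemma adj_sym (u v : 'I_77) : adj u v = adj v u.
Proof.
have : all (fun u => all (fun v => adj u v == adj v u) (iota 0 77)) (iota 0 77) by vm_compute.
by move=> /all_iota_ord/(_ u)/all_iota_ord/(_ v)/eqP.
Qed.

Lemma adj_irr (u : 'I_77) : adj u u = false.
Proof.
have : all (fun u => ~~ adj u u) (iota 0 77) by vm_compute.
by move=> /all_iota_ord/(_ u)/negbTE.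
Qed.

Lemma string_simple (u : 'I_77) : simple_pl_curve (string u).
Proof.
apply: check_simpleP; apply: (allP strings_simple); apply: mem_nth.
exact: ltn_ord.
Qed.

(** A common point rules out disjoint boxes and separation, so the check leaves only a crossing. *)
Lemma string_crossing (u v : 'I_77) i j p : u != v ->
  (i.+1 < size (string u))%N -> (j.+1 < size (string v))%N ->
  seg (nth 0 (string u) i) (nth 0 (string u) i.+1) p ->
  seg (nth 0 (string v) j) (nth 0 (string v) j.+1) p ->
  crossing_at (string u) (string v) i j.
Proof.
wlog uv : u v i j / (u < v)%N.
  move=> H ne hi hj h1 h2; have [uv|vu] : (u < v)%N \/ (v < u)%N.
    by apply/orP; rewrite -neq_ltn.
    exact: H.
  by rewrite /crossing_at crossingC; apply: H; rewrite // eq_sym.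
move=> _ hi hj h1 h2.
have := all_iota_ord (all_iota_ord string_pairs u) v; rewrite uv.
move=> /andP[_ /allP/(_ (i, j)) sep].
rewrite crossing_at_toR; apply/negPn/negP => nc.
move: h1 h2; rewrite !nth_toR => h1 h2.
have near : ~~ on_segments boxes_apart (coords u) (coords v) i j.
  by apply/negP => /boxes_apart_disjoint h; exact: (h R p).
have := sep; rewrite !mem_filter nc near (@segment_pairsP R) // => /(_ isT).
by rewrite /on_segments -(separated_toR R) => /separatedP h; exact: (h p).
Qed.

Lemma string_card (u v : 'I_77) : u != v ->
  C u `&` C v #= `I_(if adj u v then 2 else 0).
Proof.
wlog uv : u v / (u < v)%N.
  move=> H ne; have [uv|vu] : (u < v)%N \/ (v < u)%N by apply/orP; rewrite -neq_ltn.
    exact: H.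
  by rewrite setIC adj_sym; apply: H; rewrite // eq_sym.
move=> ne; have := all_iota_ord (all_iota_ord string_pairs u) v; rewrite uv => /andP[/eqP <- _].
have [_ su _] := string_simple u; have [_ sv _] := string_simple v.
rewrite -[[seq _ <- _ | _]]/(crossing_pairsZ (coords u) (coords v)) -(crossing_pairs_toR R).
by apply: card_crossing_pairs => // i j p; exact: string_crossing.
Qed.

Lemma string_disjoint (u v : 'I_77) : u != v -> ~~ adj u v -> C u `&` C v = set0.
Proof.
by move=> ne /negbTE nuv; have := string_card ne; rewrite nuv II0 card_eq0 => /eqP.
Qed.

(** A common point is interior to a segment of [u], and simplicity keeps the vertices of [u] out of
    such interiors. *)
Lemma string_vertex (u v : 'I_77) p : u != v -> C u p -> C v p -> p \notin string u.
Proof.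
move=> uv cu cv; apply/negP => pu; have [su simp _] := string_simple u.
have [i hi pi] := (pl_curveP _ _).1 cu; have [j hj pj] := (pl_curveP _ _).1 cv.
have [n1 n2 _ _] := crossing_point_neq (string_crossing uv hi hj pi pj) pi pj.
have [k hk /orP ek] := mem_vertex su pu.
have pk : seg (nth 0 (string u) k) (nth 0 (string u) k.+1) p.
  by case: ek => /eqP ->; [exact: seg_left|exact: seg_right].
have eik := pl_simple_interior simp hi hk pi n1 n2 pk.
by rewrite eik in n1 n2; case: ek; [move: n1|move: n2] => /negbTE ->.
Qed.

Lemma string_triple (u v w : 'I_77) p : u != v -> u != w -> v != w ->
  C u p -> C v p -> C w p -> False.
Proof.
move=> uv uw vw cu cv cw.
have meet (x y : 'I_77) : x != y -> C x p -> C y p -> (y : nat) \in nth [::] adj_table x.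
  move=> xy cx cy; rewrite -[_ \in _]/(adj x y); apply/negPn/negP => /(string_disjoint xy) h.
  by have : set0 p by rewrite -h; split.
have := allP (allP (all_iota_ord string_triples u) v (meet _ _ uv cu cv)) w (meet _ _ uw cu cw).
rewrite val_eqE vw /=.
have [i hi pi] := (pl_curveP _ _).1 cu; have [j hj pj] := (pl_curveP _ _).1 cv.
have [k hk pk] := (pl_curveP _ _).1 cw.
have cij := string_crossing uv hi hj pi pj; have cik := string_crossing uw hi hk pi pk.
have := string_crossing vw hj hk pj pk; rewrite crossing_at_toR => cjk.
rewrite /check_triple -!(crossing_pairs_toR R) => /allP/(_ (i, j)).
have -> : (i, j) \in crossing_pairs (string u) (string v) by apply/crossing_pairsP.
move=> /(_ isT)/allP/(_ (i, k)).
have -> : (i, k) \in crossing_pairs (string u) (string w) by apply/crossing_pairsP.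
by move=> /(_ isT); rewrite /= eqxx cjk.
Qed.

End Strings.

(** * The graph on 77 vertices and the two claims about it *)

Definition string_graph : rel 'I_77 := fun u v => adj u v.

Lemma string_graph_eq2 (R : realType) : eq2_string_graph R string_graph.
Proof.
exists (fun u : 'I_77 => string R u); split; last first.
  move=> u v uv; have := string_card R uv; case: ifP => auv h; first by right.
  by left; move: h; rewrite II0 card_eq0 => /eqP.
split.
- move=> u v uv; split=> [ne|auv].
    apply/negPn/negP => /(string_disjoint R uv) h.
    by case: ne => p; rewrite h.
  have := string_card R uv; rewrite -[adj u v]/(string_graph u v) auv => h.
  apply/set0P/eqP => e.
  move: h; rewrite e card_eq_sym card_eq0 => /eqP h.
  by have : set0 0%N by rewrite -h.
- exact: string_simple.
- by move=> u v uv; exists (if adj u v then 2 else 0)%N; exact: string_card.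
- move=> u v w uv uw vw; rewrite -subset0 => p [[cu cv] cw].
  exact: (string_triple uv uw vw cu cv cw).
- move=> u v w p uv [cu cv]; apply/negP => pw.
  have [ewu|nwu] := eqVneq w u; first by have /negP := string_vertex uv cu cv; rewrite -ewu.
  have [ewv|nwv] := eqVneq w v.
    have vu : v != u by rewrite eq_sym.
    by have /negP := string_vertex vu cv cu; rewrite -ewv; apply.
  (* A vertex of a third string would be a common point of three strings. *)
  have [sw _ _] := string_simple R w.
  apply: (@string_triple R u v w p) => //; rewrite 1?eq_sym //.
  have [k hk /orP ek] := mem_vertex sw pw; apply/pl_curveP; exists k => //.
  by case: ek => /eqP ->; [exact: seg_left|exact: seg_right].
Qed.

(** Properness keeps the vertices of each curve off the other curves, so their segments are generic.
    The odd number of common points is then the number of crossing pairs, and the crossing parity is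
    odd. *)
Lemma string_graph_not_odd (R : realType) : ~ odd_string_graph R string_graph.
Proof.
case=> c [[rep simp fin trip vert] odd].
(* The family is extended to all natural numbers, by which the strings are indexed in the
   computations. *)
pose r i := c (inord i).
have rE (i : 'I_77) : r i = c i by rewrite /r inord_val.
have inordE i : (i < 77)%N -> exists i' : 'I_77, i' = i :> nat.
  by move=> h; exists (Ordinal h).
have ne (i j : 'I_77) : (i : nat) != j -> i != j by rewrite val_eqE.
apply: (@odd_strings_absurd R r).
- by move=> _ /inordE[i <-]; rewrite rE; case: (simp i).
- move=> _ _ /inordE[i <-] /inordE[j <-] /ne ij nij; rewrite !rE.
  apply/seteqP; split=> // p hp; apply: (negP nij).
  by apply/(rep i j ij); exists p.
- move=> _ _ /inordE[i <-] /inordE[j <-] /ne ij aij; rewrite !rE.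
  exact/(rep i j ij).
- by move=> _ _ /inordE[i <-] /inordE[j <-] /ne ij; rewrite !rE; exact: fin.
- move=> _ _ /inordE[i <-] /inordE[j <-] /ne ij aij; rewrite /first_end /tail_pts !rE.
  have [si pi _] := simp i; have [sj pj _] := simp j.
  have off x y k : x != y -> (k < size (c x))%N -> ~ pl_curve (c y) (nth 0 (c x) k).
    move=> xy hk cy; have [sx _ _] := simp x; have xk := mem_nth 0 hk.
    have [l hl /orP el] := mem_vertex sx xk.
    have cx : pl_curve (c x) (nth 0 (c x) k).
      apply/pl_curveP; exists l => //.
      by case: el => /eqP ->; [exact: seg_left|exact: seg_right].
    by have /negP := vert x y x _ xy (conj cx cy); apply.
  have gen k l : (k.+1 < size (c i))%N -> (l.+1 < size (c j))%N ->
      generic (nth 0 (c i) k) (nth 0 (c i) k.+1) (nth 0 (c j) l) (nth 0 (c j) l.+1).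
    move=> hk hl; have ji : j != i by rewrite eq_sym.
    split=> h; [apply: (off i j k ij (ltnW hk))|apply: (off i j k.+1 ij hk)|
      apply: (off j i l ji (ltnW hl))|apply: (off j i l.+1 ji hl)];
      apply/pl_curveP; by [exists l|exists k].
  have cd := card_crossing_pairs pi pj
    (fun k l p hk hl h1 h2 => generic_crossing (gen k l hk hl) h1 h2).
  have [e|[n on cn]] := odd i j ij.
    by have [p] := (rep i j ij).2 aij; rewrite e.
  have en : n = size (crossing_pairs (c i) (c j)).
    by apply/card_eq_II; apply: card_eq_trans cd; rewrite card_eq_sym.
  move: si sj on gen; rewrite en.
  case: (c i) => [//|a s] _; case: (c j) => [//|b t] _ on gen /=.
  by rewrite crossing_parity_odd.
Qed.

Theorem theorem4 (R : realType) :
  exists (V : finType) (E : rel V),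
    [/\ symmetric E, irreflexive E, eq2_string_graph R E
      & ~ odd_string_graph R E].
Proof.
exists 'I_77, string_graph; split.
- exact: adj_sym.
- exact: adj_irr.
- exact: string_graph_eq2.
- exact: string_graph_not_odd.
Qed.
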